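(* Suppose $\sigma(A)\cap\Delta\neq\varnothing$ (i.e. $d\ge 1$) and $\delta(\mathcal{L}(\Delta),\mathcal{L})<1$. Then $$0<\gamma:=\min\sigma_{\mathrm{dis}}(EPE).$$ For each $n$, let $\mathcal{M}_n\subset\mathcal{L}_n(\Delta)$ be the spectral subspace of the self-adjoint operator $Q_nP|_{\mathcal{L}_n(\Delta)}:\mathcal{L}_n(\Delta)\to\mathcal{L}_n(\Delta)$ associated to the interval $[\gamma/2,1]$ (the span of its eigenvectors with eigenvalues in $[\gamma/2,1]$). Then, as $n\to\infty$, $$\hat{\delta}(\mathcal{M}_n,\mathcal{L}(\Delta))\to 0.$$ If $A$ is bounded, then $$d_{H}(\sigma(A,\mathcal{M}_n),\{\lambda_1,\dots,\lambda_d\})\to 0.$$ If $A$ is semi-bounded, then $$\hat{\delta}_{\mathfrak{a}}(\mathcal{M}_n,\mathcal{L}(\Delta))\to 0\quad\text{and}\quad d_{H}(\sigma(A,\mathcal{M}_n),\{\lambda_1,\dots,\lambda_d\})\to 0.$$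
   Context: $\mathcal{H}$ is an infinite-dimensional Hilbert space with inner product $\langle\cdot,\cdot\rangle$ and norm $\|\cdot\|$. $A$ is a bounded, or semi-bounded from below, self-adjoint operator on $\mathcal{H}$; $\mathfrak{a}$ is its (closed) quadratic form, and $m:=\min\sigma(A)$. $\mathcal{H}_{\mathfrak{a}}$ is the Hilbert space $\mathrm{Dom}(\mathfrak{a})$ with inner product $\langle u,v\rangle_{\mathfrak{a}}:=\mathfrak{a}[u,v]-(m-1)\langle u,v\rangle$ and norm $\|u\|_{\mathfrak{a}}=\|(A-m+1)^{1/2}u\|$. $a<b$ are real numbers in the resolvent set $\rho(A)$, $\Delta=[a,b]$, and $\sigma_{\mathrm{ess}}(A)\cap\Delta=\varnothing$. Write $\sigma(A)\cap\Delta=\{\lambda_1,\dots,\lambda_d\}$, eigenvalues repeated according to multiplicity ($d<\infty$). $\mathcal{L}(\Delta)$ is the spectral subspace (span of eigenvectors) of $A$ associated to $\sigma(A)\cap\Delta$, and $E$ is the orthogonal projection of $\mathcal{H}$ onto $\mathcal{L}(\Delta)$, so $\mathrm{Rank}(E)=d$. $(\mathcal{L}_n)$ is a sequence of finite-dimensional subspaces of $\mathcal{H}_{\mathfrak{a}}$ such that for every $u\in\mathrm{Dom}(\mathfrak{a})$ there are $u_n\in\mathcal{L}_n$ with $\|u-u_n\|_{\mathfrak{a}}\to 0$. $A_n$ is the self-adjoint operator on $\mathcal{L}_n$ with $\langle A_nu,v\rangle=\mathfrak{a}[u,v]$ for all $u,v\in\mathcal{L}_n$. $\mathcal{L}_n(\Delta)\subset\mathcal{L}_n$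 is the span of the eigenvectors of $A_n$ with eigenvalues in $\Delta$, and $Q_n$ is the orthogonal projection of $\mathcal{H}$ onto $\mathcal{L}_n(\Delta)$. For a finite-dimensional subspace $\mathcal{N}\subset\mathrm{Dom}(\mathfrak{a})$, the set of Galerkin eigenvalues $\sigma(A,\mathcal{N})$ is the set of $\mu\in\mathbb{R}$ for which there is $0\ne u\in\mathcal{N}$ with $\mathfrak{a}[u,v]=\mu\langle u,v\rangle$ for all $v\in\mathcal{N}$. $\mathcal{L}$ is a fixed finite-dimensional subspace of $\mathcal{H}$ and $P$ is the orthogonal projection of $\mathcal{H}$ onto $\mathcal{L}$. For subspaces $\mathcal{X},\mathcal{Y}$ of $\mathcal{H}$: $\delta(\mathcal{X},\mathcal{Y})=\sup_{u\in\mathcal{X},\|u\|=1}\mathrm{dist}(u,\mathcal{Y})$ (with $\delta(\{0\},\mathcal{Y})=0$) and $\hat\delta(\mathcal{X},\mathcal{Y})=\max\{\delta(\mathcal{X},\mathcal{Y}),\delta(\mathcal{Y},\mathcal{X})\}$; $\delta_{\mathfrak{a}},\hat\delta_{\mathfrak{a}}$ denote the same quantities computed in the Hilbert space $\mathcal{H}_{\mathfrak{a}}$. $d_H$ is the Hausdorff distance between subsets of $\mathbb{R}$ (equal to $+\infty$ if exactly one of the sets is empty). For a self-adjoint operator $T$, $\sigma_{\mathrm{dis}}(T)$ is the set of isolated eigenvalues of finite multiplicity and $\sigma_{\mathrm{ess}}(T)=\sigma(T)\setminus\sigma_{\mathrm{dis}}(T)$. *)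

(* Defs.v *)
From HB Require Import structures.
From mathcomp Require Import all_boot all_order all_algebra.
From mathcomp Require Export complex.
From mathcomp Require Import all_classical all_reals all_analysis.

Set Implicit Arguments.
Unset Strict Implicit.
Unset Printing Implicit Defensive.

Import Order.TTheory GRing.Theory Num.Theory.
Import numFieldNormedType.Exports.

Local Open Scope classical_set_scope.
Local Open Scope ring_scope.
Local Open Scope complex_scope.

(* Complex Hilbert spaces are completeNormedModType's over R[i], R : realType,
   together with an inner product ip : {dot H for Num.conj} such that
   ip u u = `|u| ^+ 2. Inner products and forms are linear in the first
   argument and conjugate-linear in the second one. On R[i], the order x <= y
   means that y - x is a nonnegative real. *)

Section LinearSubspaces.
Context (R : realType) (H : lmodType R[i]).
Implicit Types (S V : set H).

Definition is_subspace V :=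
  V 0 /\ forall (c : R[i]) u v, V u -> V v -> V (c *: u + v).

Definition lspan S : set H := smallest is_subspace S.

Definition findim_subspace V := exists2 S, finite_set S & V = lspan S.

End LinearSubspaces.

Section InnerProductGeometry.
Context (R : realType) (H : lmodType R[i]).
(* g is either the inner product of H or that of the form space H_a *)
Context (g : H -> H -> R[i]).
Implicit Types (V X Y : set H).

Definition ip_norm (u : H) : R := Num.sqrt (complex.Re (g u u)).

(* Meaningful for subspaces V on which the projection exists, such as the
   finite-dimensional ones; the default value 0 is then never used. *)
Definition orthproj V (u : H) : H :=
  xget 0 [set p | V p /\ forall v, V v -> g (u - p) v = 0].

Definition dist_to (u : H) Y : R := inf [set ip_norm (u - v) | v in Y].

(* delta(X, Y); for X = {0} this is sup set0 = 0. *)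
Definition gap X Y : R :=
  sup [set dist_to u Y | u in [set u | X u /\ ip_norm u = 1]].

Definition gap_hat X Y : R := Num.max (gap X Y) (gap Y X).

End InnerProductGeometry.

Section Operators.
Context (R : realType) (H : normedModType R[i]).

(* A possibly unbounded operator: the values of op_fun outside op_dom are
   irrelevant. *)
Record operator := Operator { op_dom : set H ; op_fun :> H -> H }.

Implicit Types T : operator.

Definition linear_operator T := is_subspace (op_dom T) /\
  forall (c : R[i]) u v, op_dom T u -> op_dom T v ->
    T (c *: u + v) = c *: T u + T v.

Definition bounded_operator T := op_dom T = setT /\
  exists M : R, forall u, `|T u| <= M%:C * `|u|.

Definition resolvent_set T : set R[i] := [set z |
  exists S : {linear H -> H}, [/\ continuous S,
    forall v, op_dom T (S v) /\ T (S v) - z *: S v = v &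
    forall u, op_dom T u -> S (T u - z *: u) = u] ].

Definition spectrum T : set R[i] := ~` resolvent_set T.

Definition eigenvector T (z : R[i]) (u : H) :=
  [/\ op_dom T u, u != 0 & T u = z *: u].

Definition isolated_in (S : set R[i]) (z : R[i]) := S z /\
  exists2 e : R, 0 < e & forall w, S w -> `|w - z| < e%:C -> w = z.

Definition discrete_spectrum T : set R[i] := [set z |
  [/\ isolated_in (spectrum T) z, exists u, eigenvector T z u &
      findim_subspace [set u | op_dom T u /\ T u = z *: u] ] ].

Definition essential_spectrum T : set R[i] :=
  spectrum T `\` discrete_spectrum T.

(* The part in the real line of a set of complex numbers; nothing is lost for
   the various spectra of a self-adjoint operator. *)
Definition real_trace (S : set R[i]) : set R := [set x | S x%:C].

Definition spectral_span T (I : set R) : set H :=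
  lspan [set u | exists2 x, I x & eigenvector T x%:C u].

Context (ip : H -> H -> R[i]).

(* T is densely defined and the graph of T is that of its adjoint. *)
Definition selfadjoint T :=
  [/\ linear_operator T, dense (op_dom T) &
      forall v w, (op_dom T v /\ T v = w) <->
        (forall u, op_dom T u -> ip (T u) v = ip u w)].

Definition semibounded_operator T :=
  exists c : R, forall u, op_dom T u -> c%:C * ip u u <= ip (T u) u.

End Operators.

Section Forms.
Context (R : realType) (H : normedModType R[i]).
Context (ip : H -> H -> R[i]).

Record qform := QForm { form_dom : set H ; form_fun :> H -> H -> R[i] }.

Implicit Types q : qform.

Definition symmetric_form q :=
  [/\ is_subspace (form_dom q),
      forall (c : R[i]) u v w, form_dom q u -> form_dom q v -> form_dom q w ->
        q (c *: u + v) w = c * q u w + q v w &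
      forall u v, form_dom q u -> form_dom q v -> q u v = (q v u)^*%C].

Definition semibounded_form q :=
  exists c : R, forall u, form_dom q u -> c%:C * ip u u <= q u u.

Definition closed_form q := forall (u_ : nat -> H) (u : H),
  (forall n, form_dom q (u_ n)) -> u_ @ \oo --> u ->
  complex.Re (q (u_ p.1 - u_ p.2) (u_ p.1 - u_ p.2)) @[p --> (\oo, \oo)] --> (0 : R) ->
  form_dom q u /\ complex.Re (q (u_ n - u) (u_ n - u)) @[n --> \oo] --> (0 : R).

(* By the first representation theorem, the quadratic form of a self-adjoint
   semi-bounded operator A is the unique densely defined, symmetric,
   semi-bounded and closed form whose associated operator is A. *)
Definition form_of (A : operator H) q :=
  [/\ dense (form_dom q), symmetric_form q, semibounded_form q, closed_form q &
      forall u w, (op_dom A u /\ A u = w) <->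
        (form_dom q u /\ forall v, form_dom q v -> q u v = ip w v)].

Definition form_ip q (m : R) (u v : H) : R[i] :=
  q u v - (m - 1)%:C * ip u v.

(* The operator A_N on the finite-dimensional subspace N of form_dom q with
   ip (A_N u) v = q u v for u, v in N; it exists and is unique by the Riesz
   representation theorem on N. *)
Definition galerkin_operator q (N : set H) : operator H :=
  Operator N (fun u => xget 0 [set w | N w /\ forall v, N v -> ip w v = q u v]).

Definition galerkin_spectrum q (N : set H) : set R := [set x |
  exists u, [/\ N u, u != 0 & forall v, N v -> q u v = x%:C * ip u v] ].

End Forms.

Section RealSets.
Context (R : realType).
Implicit Types S T : set R.

Definition is_min S (x : R) := S x /\ forall y, S y -> x <= y.

(* Extended-real valued: +oo if exactly one of the sets is empty. The outer
   maximum with 0 only matters for S = T = set0. *)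
Definition hausdorff_dist S T : \bar R :=
  let excess X Y := ereal_sup
    [set ereal_inf [set `|x - y|%:E | y in Y] | x in X] in
  maxe 0%E (maxe (excess S T) (excess T S)).

End RealSets.

(* Main.v *)
Require Import Defs.
From HB Require Import structures.
From mathcomp Require Import all_boot all_order all_algebra.
From mathcomp Require Import complex.
From mathcomp Require Import all_classical all_reals all_analysis.
From mathcomp Require Import ring lra.

(** The theorem rests on the strong convergence of the Galerkin spectral
    projections [Q n] to the spectral projection [E] of [A].

    Eigenvectors of [A] in the interval are approximated in the form norm by
    Galerkin spectral subspaces ([LDelta_approximable]): the residual of a good
    trial vector is small, and its part outside of the interval is controlled by
    testing with a sign-changed copy of that part. Conversely the Galerkin
    spectral subspaces, which may be polluted, become orthogonal to every [v] in
    the orthogonal complement of the spectral subspace of [A]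
    ([LnDelta_orthogonal]). There [A - c], [c] being the midpoint of the interval,
    is invertible with [|(A - c)^-1| <= 1 / r'] and [r'] larger than the
    half-width [r], while the compression of [A - c] to the Galerkin spectral
    subspace has norm at most [r]; moving powers of [A - c] from one factor of
    [<x, v>] to the other gives [(r / r')^k] for every [k].

    The bound [r' > r] replaces the spectral theorem. A symmetric operator with
    [|(A - x) u| >= t |u|] for which [x + t] and [x - t] are regular satisfies a
    better bound ([lower_bound_improve]), so the best constant is the distance to
    the spectrum. An isolated eigenvalue is regular on the orthogonal complement
    of its eigenspace: for [G := A - x] the bounded positive operator
    [D := G (G - s)^-1] satisfies [D^2 >= c D], which isolates zero in its
    spectrum, and a Neumann series inverts [D] ([isolated_solvable]).

    As [P] has finite rank, [Q n P] converges to [E P] in norm and the pollution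
    disappears: on the spectral subspace of [A] the operator [EPE] is at least
    [gamma > 0], so the part of [Q n P] with eigenvalues in [[gamma / 2, 1]]
    converges to it ([M_near_LDelta], [eigenvector_approximable]). Galerkin
    spectral subspaces carry uniformly equivalent norms, hence the convergence
    also holds in the form norm, and testing the Galerkin eigenvalue equations
    with eigenvectors of [A] gives the convergence of the eigenvalues
    ([galerkin_spectrum_cvg]). *)

Set Implicit Arguments.
Unset Strict Implicit.
Unset Printing Implicit Defensive.

Import Order.TTheory GRing.Theory Num.Theory.
Import numFieldNormedType.Exports.

Local Open Scope classical_set_scope.
Local Open Scope ring_scope.
Local Open Scope complex_scope.

(** * Complex scalars and subspaces *)

Section ComplexScalars.
Context (R : realType).
Implicit Types (z w : R[i]) (x y : R).

Lemma conjCE z : Num.conj z = conjc z.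
Proof. by []. Qed.

Lemma ReD z w : complex.Re (z + w) = complex.Re z + complex.Re w.
Proof. by case: z; case: w. Qed.

Lemma ReN z : complex.Re (- z) = - complex.Re z.
Proof. by case: z. Qed.

Lemma ReB z w : complex.Re (z - w) = complex.Re z - complex.Re w.
Proof. by rewrite ReD ReN. Qed.

Lemma ReJ z : complex.Re (conjc z) = complex.Re z.
Proof. by case: z. Qed.

Lemma ReZ x z : complex.Re (x%:C * z) = x * complex.Re z.
Proof. by case: z => a b /=; rewrite mul0r subr0. Qed.

Lemma Re_sum (I : finType) (F : I -> R[i]) :
  complex.Re (\sum_i F i) = \sum_i complex.Re (F i).
Proof. by apply: (big_morph (@complex.Re R)); [exact: ReD|]. Qed.

Lemma conjM z w : conjc (z * w) = conjc z * conjc w.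
Proof. exact: rmorphM. Qed.

Lemma conjD z w : conjc (z + w) = conjc z + conjc w.
Proof. exact: rmorphD. Qed.

Lemma conjB z w : conjc (z - w) = conjc z - conjc w.
Proof. exact: rmorphB. Qed.

Lemma realCD x y : (x + y)%:C = x%:C + y%:C.
Proof. exact: rmorphD. Qed.

Lemma realCB x y : (x - y)%:C = x%:C - y%:C.
Proof. exact: rmorphB. Qed.

Lemma realCM x y : (x * y)%:C = x%:C * y%:C.
Proof. exact: rmorphM. Qed.

(** The modulus as an element of [R]; the norm of [R[i]] has values in
    [R[i]]. *)
Definition modulus z : R := complex.Re `|z|.

Lemma modulusC z : `|z| = (modulus z)%:C.
Proof. by rewrite /modulus RRe_real// normr_real. Qed.

Lemma modulus_ge0 z : 0 <= modulus z.
Proof. by rewrite -lecR -modulusC normr_ge0. Qed.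

Lemma modulusM z w : modulus (z * w) = modulus z * modulus w.
Proof. by apply: complexI; rewrite realCM -!modulusC normrM. Qed.

Lemma modulus_real x : modulus x%:C = `|x|.
Proof. by rewrite /modulus normc_def /= expr0n/= addr0 sqrtr_sqr. Qed.

Lemma modulus_sq z : (modulus z ^+ 2)%:C = z * conjc z.
Proof. by rewrite -sqr_normc modulusC -rmorphXn. Qed.

Lemma modulus_conj z : modulus (conjc z) = modulus z.
Proof. by rewrite /modulus normcJ. Qed.

Lemma modulus_eq0 z : modulus z = 0 -> z = 0.
Proof. by move=> z0; apply/eqP; rewrite -normr_eq0 modulusC z0. Qed.

End ComplexScalars.

Section Subspaces.
Context (R : realType) (H : lmodType R[i]).
Implicit Types (V W : set H) (S : set H).

Lemma subspace0 V : is_subspace V -> V 0.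
Proof. by case. Qed.

Lemma subspaceD V u v : is_subspace V -> V u -> V v -> V (u + v).
Proof. by move=> [_ VP] Vu Vv; have := VP 1 u v Vu Vv; rewrite scale1r. Qed.

Lemma subspaceZ V c u : is_subspace V -> V u -> V (c *: u).
Proof. by move=> [V0 VP] Vu; have := VP c u 0 Vu V0; rewrite addr0. Qed.

Lemma subspaceN V u : is_subspace V -> V u -> V (- u).
Proof. by move=> Vs Vu; rewrite -scaleN1r; exact: subspaceZ. Qed.

Lemma subspaceB V u v : is_subspace V -> V u -> V v -> V (u - v).
Proof. by move=> Vs Vu Vv; apply: subspaceD => //; exact: subspaceN. Qed.

Lemma subspace_sum V (I : finType) (p : pred I) (F : I -> H) :
  is_subspace V -> (forall i, p i -> V (F i)) -> V (\sum_(i | p i) F i).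
Proof.
move=> Vs VF; elim/big_ind : _ => [|u v Vu Vv|i pi]; first exact: subspace0.
  exact: subspaceD.
exact: VF.
Qed.

Lemma subspaceT : is_subspace [set: H].
Proof. by []. Qed.

Lemma subspaceI V W : is_subspace V -> is_subspace W -> is_subspace (V `&` W).
Proof.
move=> [V0 VP] [W0 WP]; split => // c u v [Vu Wu] [Vv Wv].
by split; [exact: VP|exact: WP].
Qed.

Lemma lspan_subspace S : is_subspace (lspan S).
Proof.
split; first by move=> V [[]].
move=> c u v Su Sv V VS; have [[_ VP] _] := VS.
by apply: VP; [exact: Su|exact: Sv].
Qed.

Lemma sub_lspan S : S `<=` lspan S.
Proof. by move=> u Su V [_]; apply. Qed.

Lemma lspan_sub S V : is_subspace V -> S `<=` V -> lspan S `<=` V.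
Proof. by move=> Vs SV u; apply; split. Qed.

End Subspaces.

(** * Positive hermitian forms *)

Section HermitianForms.
Context (R : realType) (H : lmodType R[i]).
Implicit Types (V : set H) (g : H -> H -> R[i]).

(** Inner products, quadratic forms and auxiliary forms of several proofs
    share this notion; [V] is the form domain, outside of which the values of
    [g] are arbitrary. *)
Definition hermitian_on V g :=
  [/\ is_subspace V,
      forall (c : R[i]) u v w, V u -> V v -> V w ->
        g (c *: u + v) w = c * g u w + g v w &
      forall u v, V u -> V v -> g u v = conjc (g v u)].

Definition positive_on V g :=
  hermitian_on V g /\ forall u, V u -> 0 <= complex.Re (g u u).

Lemma hermitian_onS V W g :
  is_subspace W -> W `<=` V -> hermitian_on V g -> hermitian_on W g.
Proof.
move=> Ws WV [_ gl gc]; split => // [c u v w Wu Wv Ww|u v Wu Wv].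
  by rewrite gl//; exact: WV.
by rewrite gc//; exact: WV.
Qed.

Section Fixed.
Context V g (gV : hermitian_on V g).

Let Vs : is_subspace V. Proof. by case: gV. Qed.

Lemma hermC u v : V u -> V v -> g u v = conjc (g v u).
Proof. by case: gV => _ _; apply. Qed.

Lemma hermJ u v : V u -> V v -> conjc (g u v) = g v u.
Proof. by move=> Vu Vv; rewrite -hermC. Qed.

Lemma herm0l u : V u -> g 0 u = 0.
Proof.
have [_ gl _] := gV; move=> Vu; have V0 := subspace0 Vs.
have := gl 1 0 0 u V0 V0 Vu; rewrite scale1r addr0 mul1r => /eqP.
by rewrite -subr_eq0 opprD addrA subrr sub0r oppr_eq0 => /eqP.
Qed.

Lemma hermDl u v w : V u -> V v -> V w -> g (u + v) w = g u w + g v w.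
Proof.
have [_ gl _] := gV; move=> Vu Vv Vw.
by have := gl 1 u v w Vu Vv Vw; rewrite scale1r mul1r.
Qed.

Lemma hermZl c u w : V u -> V w -> g (c *: u) w = c * g u w.
Proof.
have [_ gl _] := gV; move=> Vu Vw.
by have := gl c u 0 w Vu (subspace0 Vs) Vw; rewrite addr0 herm0l// addr0.
Qed.

Lemma hermNl u w : V u -> V w -> g (- u) w = - g u w.
Proof. by move=> Vu Vw; rewrite -scaleN1r hermZl// mulN1r. Qed.

Lemma hermBl u v w : V u -> V v -> V w -> g (u - v) w = g u w - g v w.
Proof.
by move=> Vu Vv Vw; rewrite hermDl ?hermNl//; exact: subspaceN.
Qed.

Lemma hermDr u v w : V u -> V v -> V w -> g w (u + v) = g w u + g w v.
Proof.
move=> Vu Vv Vw; rewrite hermC ?hermDl ?conjD//; last exact: subspaceD.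
by rewrite !hermJ.
Qed.

Lemma hermZr c u w : V u -> V w -> g w (c *: u) = conjc c * g w u.
Proof.
move=> Vu Vw; rewrite hermC ?hermZl ?conjM//; last exact: subspaceZ.
by rewrite hermJ.
Qed.

Lemma hermNr u w : V u -> V w -> g w (- u) = - g w u.
Proof.
by move=> Vu Vw; rewrite -scaleN1r hermZr// rmorphN1 mulN1r.
Qed.

Lemma hermBr u v w : V u -> V v -> V w -> g w (u - v) = g w u - g w v.
Proof.
by move=> Vu Vv Vw; rewrite hermDr ?hermNr//; exact: subspaceN.
Qed.

Lemma herm0r u : V u -> g u 0 = 0.
Proof. by move=> Vu; rewrite hermC ?herm0l ?conjc0//; exact: subspace0. Qed.

Lemma herm_suml (I : finType) (F : I -> H) w :
  (forall i, V (F i)) -> V w -> g (\sum_i F i) w = \sum_i g (F i) w.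
Proof.
move=> VF Vw; suff [_ ] : V (\sum_i F i) /\ g (\sum_i F i) w = \sum_i g (F i) w.
  by [].
elim/big_ind2 : _ => [|u1 z1 u2 z2 [Vu1 <-] [Vu2 <-]|//].
  by split; [exact: subspace0|exact: herm0l].
by rewrite hermDl//; split => //; exact: subspaceD.
Qed.

Lemma herm_sumr (I : finType) (F : I -> H) w :
  (forall i, V (F i)) -> V w -> g w (\sum_i F i) = \sum_i g w (F i).
Proof.
move=> VF Vw; rewrite hermC//; last by apply: subspace_sum => // i _.
rewrite herm_suml// rmorph_sum/=; apply: eq_bigr => i _.
by rewrite -[LHS]/(conjc (g (F i) w)) hermJ.
Qed.

Lemma herm_real u : V u -> g u u = (complex.Re (g u u))%:C.
Proof.
move=> Vu; have := hermC Vu Vu; case: (g u u) => a b [] /=.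
move=> /eqP; rewrite -subr_eq0 opprK -mulr2n mulrn_eq0/= => /eqP ->.
by [].
Qed.

Lemma Re_hermC u v : V u -> V v -> complex.Re (g u v) = complex.Re (g v u).
Proof. by move=> Vu Vv; rewrite hermC// ReJ. Qed.

End Fixed.

Section Positive.
Context V g (gV : positive_on V g).
Let gh : hermitian_on V g. Proof. by case: gV. Qed.
Let Vs : is_subspace V. Proof. by case: gh. Qed.

Lemma herm_ge0 u : V u -> 0 <= complex.Re (g u u).
Proof. by case: gV => _; apply. Qed.

Lemma ip_norm_ge0 u : 0 <= ip_norm g u.
Proof. exact: sqrtr_ge0. Qed.

Lemma ip_norm_sq u : V u -> ip_norm g u ^+ 2 = complex.Re (g u u).
Proof. by move=> Vu; rewrite /ip_norm sqr_sqrtr// herm_ge0. Qed.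

Lemma herm_norm_sq u : V u -> g u u = (ip_norm g u ^+ 2)%:C.
Proof. by move=> Vu; rewrite ip_norm_sq// (herm_real gh). Qed.

Lemma Re_herm_expand (t : R) u v : V u -> V v ->
  complex.Re (g (u + t%:C *: v) (u + t%:C *: v)) =
  complex.Re (g u u) + 2 * t * complex.Re (g u v) +
    t ^+ 2 * complex.Re (g v v).
Proof.
move=> Vu Vv; have Vtv := subspaceZ t%:C Vs Vv.
have Vutv := subspaceD Vs Vu Vtv.
rewrite (hermDl gh)// !(hermDr gh)// !(hermZl gh)// !(hermZr gh)//.
rewrite conjc_real !ReD !ReZ (Re_hermC gh Vv Vu); ring.
Qed.

(** Cauchy-Schwarz for semi-definite forms, from the sign of the discriminant
    of the quadratic polynomial [t |-> g (u + t v) (u + t v)]. *)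
Lemma cauchy_schwarz_sq u v : V u -> V v ->
  complex.Re (g u v) ^+ 2 <= complex.Re (g u u) * complex.Re (g v v).
Proof.
move=> Vu Vv.
set A := complex.Re (g u u); set B := complex.Re (g u v).
set D := complex.Re (g v v).
have q t : 0 <= A + 2 * t * B + t ^+ 2 * D.
  rewrite -Re_herm_expand//; apply: herm_ge0.
  by apply: subspaceD => //; exact: subspaceZ.
have D0 : 0 <= D by exact: herm_ge0.
have [D_eq0|Dn0] := eqVneq D 0.
  have [->|Bn0] := eqVneq B 0; first by rewrite expr0n/= D_eq0 mulr0.
  have := q (- (A + 1) / (2 * B)).
  rewrite D_eq0 mulr0 addr0.
  have -> : A + 2 * (- (A + 1) / (2 * B)) * B = -1 by field.
  by rewrite oppr_ge0 ler10.
have Dgt0 : 0 < D by rewrite lt_neqAle eq_sym Dn0.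
have := q (- B / D).
have -> : A + 2 * (- B / D) * B + (- B / D) ^+ 2 * D = (A * D - B ^+ 2) / D.
  by field.
by rewrite pmulr_lge0 ?invr_gt0// subr_ge0.
Qed.

Lemma cauchy_schwarz u v : V u -> V v ->
  complex.Re (g u v) <= ip_norm g u * ip_norm g v.
Proof.
move=> Vu Vv; have := cauchy_schwarz_sq Vu Vv.
rewrite -!ip_norm_sq// -exprMn => h.
rewrite (le_trans (ler_norm _))// -ler_sqr ?nnegrE ?mulr_ge0 ?ip_norm_ge0//.
by rewrite real_normK ?num_real.
Qed.

Lemma ip_normZ c u : V u -> ip_norm g (c *: u) = modulus c * ip_norm g u.
Proof.
move=> Vu; have Vcu := subspaceZ c Vs Vu.
apply/eqP; rewrite -(@eqrXn2 _ 2)// ?mulr_ge0 ?ip_norm_ge0 ?modulus_ge0//.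
rewrite exprMn !ip_norm_sq// (hermZl gh)// (hermZr gh)// mulrA -modulus_sq.
by rewrite ReZ.
Qed.

Lemma cauchy_schwarz_modulus u v : V u -> V v ->
  modulus (g u v) <= ip_norm g u * ip_norm g v.
Proof.
move=> Vu Vv; set z := g u v; set r := modulus z.
have [z0|zn0] := eqVneq r 0.
  by rewrite z0 mulr_ge0 ?ip_norm_ge0.
have r0 : 0 < r by rewrite lt_neqAle eq_sym zn0 modulus_ge0.
(* turning u by the phase of g u v makes the product real *)
have := cauchy_schwarz (subspaceZ (conjc z) Vs Vu) Vv.
rewrite (hermZl gh)// ip_normZ// modulus_conj -/z -/r mulrC -modulus_sq /=.
by rewrite -/r expr2 -mulrA ler_pM2l.
Qed.

Lemma ip_normD u v : V u -> V v ->
  ip_norm g (u + v) <= ip_norm g u + ip_norm g v.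
Proof.
move=> Vu Vv; rewrite -ler_sqr ?nnegrE ?addr_ge0 ?ip_norm_ge0//.
have -> : v = 1%:C *: v by rewrite scale1r.
rewrite ip_norm_sq; last by rewrite scale1r; exact: subspaceD.
rewrite Re_herm_expand// scale1r.
have := cauchy_schwarz Vu Vv; rewrite -!ip_norm_sq//; nra.
Qed.

Lemma ip_norm0 : ip_norm g 0 = 0.
Proof. by rewrite /ip_norm (herm0l gh) ?sqrtr0//; exact: subspace0. Qed.

Lemma ip_normN u : V u -> ip_norm g (- u) = ip_norm g u.
Proof.
by move=> Vu; rewrite -scaleN1r ip_normZ// /modulus normrN1 mul1r.
Qed.

Lemma ip_normB u v : V u -> V v -> ip_norm g (u - v) = ip_norm g (v - u).
Proof.
by move=> Vu Vv; rewrite -[u - v]opprB ip_normN//; exact: subspaceB.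
Qed.

Lemma ip_norm_sum (I : finType) (F : I -> H) : (forall i, V (F i)) ->
  ip_norm g (\sum_i F i) <= \sum_i ip_norm g (F i).
Proof.
move=> VF; suff [_ ] : V (\sum_i F i) /\
    ip_norm g (\sum_i F i) <= \sum_i ip_norm g (F i) by [].
elim/big_ind2 : _ => [|u x v y [Vu ux] [Vv vy]|//].
  by rewrite ip_norm0; split => //; exact: subspace0.
split; first exact: subspaceD.
by rewrite (le_trans (ip_normD _ _))// lerD.
Qed.

End Positive.
End HermitianForms.

(** * Orthonormal bases of finite-dimensional subspaces *)

Section InnerProduct.
Context (R : realType) (H : normedModType R[i]).

Definition inner_product (ip : H -> H -> R[i]) :=
  hermitian_on setT ip /\ forall u, ip u u = `|u| ^+ 2.

Context (ip : H -> H -> R[i]) (ipP : inner_product ip).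
Implicit Types (u v w : H) (V W : set H).
Local Notation N := (ip_norm ip).

Let iph : hermitian_on setT ip. Proof. by case: ipP. Qed.

Lemma norm_ip u : `|u| = (N u)%:C.
Proof.
rewrite /ip_norm; have -> : ip u u = `|u| ^+ 2 by case: ipP.
have /complex_realP[x ux] : `|u| \is Num.real by exact: normr_real.
have x0 : 0 <= x by rewrite -lecR -ux normr_ge0.
by rewrite ux -rmorphXn/= sqrtr_sqr ger0_norm.
Qed.

Lemma ip_positive : positive_on setT ip.
Proof.
split=> // u _; have -> : ip u u = `|u| ^+ 2 by case: ipP.
by rewrite norm_ip -rmorphXn/= exprn_ge0// sqrtr_ge0.
Qed.

Lemma ipC u v : ip u v = conjc (ip v u). Proof. exact: (hermC iph). Qed.
Lemma ipJ u v : conjc (ip u v) = ip v u. Proof. exact: (hermJ iph). Qed.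
Lemma ip0l u : ip 0 u = 0. Proof. exact: (herm0l iph). Qed.
Lemma ip0r u : ip u 0 = 0. Proof. exact: (herm0r iph). Qed.
Lemma ipDl u v w : ip (u + v) w = ip u w + ip v w.
Proof. exact: (hermDl iph). Qed.
Lemma ipDr u v w : ip w (u + v) = ip w u + ip w v.
Proof. exact: (hermDr iph). Qed.
Lemma ipNr u w : ip w (- u) = - ip w u. Proof. exact: (hermNr iph). Qed.
Lemma ipBl u v w : ip (u - v) w = ip u w - ip v w.
Proof. exact: (hermBl iph). Qed.
Lemma ipBr u v w : ip w (u - v) = ip w u - ip w v.
Proof. exact: (hermBr iph). Qed.
Lemma ipZl c u w : ip (c *: u) w = c * ip u w.
Proof. exact: (hermZl iph). Qed.
Lemma ipZr c u w : ip w (c *: u) = conjc c * ip w u.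
Proof. exact: (hermZr iph). Qed.
Lemma ip_suml (I : finType) (F : I -> H) w :
  ip (\sum_i F i) w = \sum_i ip (F i) w.
Proof. exact: (herm_suml iph). Qed.
Lemma ip_sumr (I : finType) (F : I -> H) w :
  ip w (\sum_i F i) = \sum_i ip w (F i).
Proof. exact: (herm_sumr iph). Qed.
Lemma Re_ipC u v : complex.Re (ip u v) = complex.Re (ip v u).
Proof. exact: (Re_hermC iph). Qed.

Lemma nm_ge0 u : 0 <= N u. Proof. exact: ip_norm_ge0. Qed.
Lemma nm_sq u : N u ^+ 2 = complex.Re (ip u u).
Proof. exact: (ip_norm_sq ip_positive). Qed.
Lemma ipE u : ip u u = (N u ^+ 2)%:C.
Proof. exact: (herm_norm_sq ip_positive). Qed.
Lemma nmD u v : N (u + v) <= N u + N v.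
Proof. exact: (ip_normD ip_positive). Qed.
Lemma nmZ c u : N (c *: u) = modulus c * N u.
Proof. exact: (ip_normZ ip_positive). Qed.
Lemma nm0 : N 0 = 0. Proof. exact: (ip_norm0 ip_positive). Qed.
Lemma nmN u : N (- u) = N u. Proof. exact: (ip_normN ip_positive). Qed.
Lemma nmC u v : N (u - v) = N (v - u).
Proof. exact: (ip_normB ip_positive). Qed.
Lemma nm_sum (I : finType) (F : I -> H) : N (\sum_i F i) <= \sum_i N (F i).
Proof. exact: (ip_norm_sum ip_positive). Qed.
Lemma ip_cs u v : complex.Re (ip u v) <= N u * N v.
Proof. exact: (cauchy_schwarz ip_positive). Qed.
Lemma ip_cs_modulus u v : modulus (ip u v) <= N u * N v.
Proof. exact: (cauchy_schwarz_modulus ip_positive). Qed.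

Lemma nm_eq0 u : N u = 0 -> u = 0.
Proof. by move=> u0; apply/eqP; rewrite -normr_eq0 norm_ip u0. Qed.

Lemma nm_gt0 u : u != 0 -> 0 < N u.
Proof.
move=> u0; rewrite lt_neqAle nm_ge0 andbT eq_sym.
by apply: contra u0 => /eqP/nm_eq0 ->.
Qed.

Lemma nmB u v : N (u - v) <= N u + N v.
Proof. by rewrite (le_trans (nmD _ _))// nmN. Qed.

Lemma nm_triangle w u v : N (u - v) <= N (u - w) + N (w - v).
Proof.
have -> : u - v = (u - w) + (w - v) by rewrite addrA subrK.
exact: nmD.
Qed.

Lemma nmZr (x : R) u : N (x%:C *: u) = `|x| * N u.
Proof. by rewrite nmZ modulus_real. Qed.

Lemma nm_sqD u v : N (u + v) ^+ 2 =
  N u ^+ 2 + 2 * complex.Re (ip u v) + N v ^+ 2.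
Proof.
have := Re_herm_expand ip_positive 1 (I : setT u) (I : setT v).
by rewrite scale1r -!nm_sq expr1n mul1r mulr1.
Qed.

Definition onb V k (f : 'I_k -> H) :=
  [/\ forall i, V (f i), forall i j, ip (f i) (f j) = (i == j)%:R &
      forall u, V u -> u = \sum_i ip u (f i) *: f i].

Section OrthonormalBasis.
Context V k (f : 'I_k -> H) (Vs : is_subspace V) (fV : onb V f).

Lemma onb_in i : V (f i). Proof. by case: fV. Qed.
Lemma onb_ip i j : ip (f i) (f j) = (i == j)%:R. Proof. by case: fV. Qed.
Lemma onb_expand u : V u -> u = \sum_i ip u (f i) *: f i.
Proof. by case: fV => _ _; apply. Qed.

Lemma onb_nm i : N (f i) = 1.
Proof.
apply/eqP; rewrite -(@eqrXn2 _ 2)// ?nm_ge0// nm_sq onb_ip eqxx expr1n.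
by [].
Qed.

Lemma onb_neq0 i : f i != 0.
Proof.
by apply/eqP => fi0; have := onb_nm i; rewrite fi0 nm0 => /eqP; rewrite eq_sym oner_eq0.
Qed.

Lemma onb_sum (c : 'I_k -> R[i]) : V (\sum_i c i *: f i).
Proof. by apply: subspace_sum => // i _; apply: subspaceZ => //; exact: onb_in. Qed.

Lemma onb_coord (c : 'I_k -> R[i]) j : ip (\sum_i c i *: f i) (f j) = c j.
Proof.
rewrite ip_suml (bigD1 j)//= ipZl onb_ip eqxx mulr1 big1 ?addr0// => i ij.
by rewrite ipZl onb_ip (negbTE ij) mulr0.
Qed.

Lemma onb_ext u v : V u -> V v -> (forall i, ip u (f i) = ip v (f i)) -> u = v.
Proof.
move=> Vu Vv uv; rewrite (onb_expand Vu) (onb_expand Vv).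
by apply: eq_bigr => i _; rewrite uv.
Qed.

Lemma onb_parseval u v : V v ->
  ip u v = \sum_i ip u (f i) * conjc (ip v (f i)).
Proof.
move=> Vv; rewrite {1}(onb_expand Vv) ip_sumr.
by apply: eq_bigr => i _; rewrite ipZr mulrC.
Qed.

Lemma onb_nm_sq u : V u -> N u ^+ 2 = \sum_i modulus (ip u (f i)) ^+ 2.
Proof.
move=> Vu; apply: complexI; rewrite -ipE (onb_parseval _ Vu) rmorph_sum/=.
by apply: eq_bigr => i _; rewrite modulus_sq.
Qed.

Lemma onb_coord_le u i : modulus (ip u (f i)) <= N u.
Proof. by rewrite (le_trans (ip_cs_modulus _ _))// onb_nm mulr1. Qed.

Lemma orthproj_onb u : orthproj ip V u = \sum_i ip u (f i) *: f i.
Proof.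
rewrite /orthproj; case: xgetP => [p _ [Vp pV]|]; last first.
  move=> /(_ (\sum_i ip u (f i) *: f i)) []; split; first exact: onb_sum.
  move=> v Vv; rewrite ipBl; apply/eqP; rewrite subr_eq0; apply/eqP.
  rewrite (onb_parseval u Vv) (onb_parseval _ Vv).
  by apply: eq_bigr => i _; rewrite onb_coord.
apply: onb_ext => // [|i]; first exact: onb_sum.
have := pV _ (onb_in i); rewrite onb_coord ipBl => /eqP.
by rewrite subr_eq0 => /eqP ->.
Qed.

Lemma orthproj_in u : V (orthproj ip V u).
Proof. by rewrite orthproj_onb; exact: onb_sum. Qed.

Lemma orthproj_ip u v : V v -> ip (orthproj ip V u) v = ip u v.
Proof.
move=> Vv; rewrite (onb_parseval u Vv) (onb_parseval _ Vv).
by apply: eq_bigr => i _; rewrite orthproj_onb onb_coord.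
Qed.

Lemma orthproj_orth u v : V v -> ip (u - orthproj ip V u) v = 0.
Proof. by move=> Vv; rewrite ipBl orthproj_ip// subrr. Qed.

Lemma orthproj_id u : V u -> orthproj ip V u = u.
Proof. by move=> Vu; rewrite orthproj_onb -onb_expand. Qed.

Lemma orthproj_eq0 u : (forall v, V v -> ip u v = 0) -> orthproj ip V u = 0.
Proof.
move=> uV; rewrite orthproj_onb big1// => i _.
by rewrite uV ?scale0r//; exact: onb_in.
Qed.

Lemma orthproj_lin c u v :
  orthproj ip V (c *: u + v) = c *: orthproj ip V u + orthproj ip V v.
Proof.
rewrite !orthproj_onb scaler_sumr -big_split/=; apply: eq_bigr => i _.
by rewrite ipDl ipZl scalerDl scalerA.
Qed.

Lemma orthprojD u v :
  orthproj ip V (u + v) = orthproj ip V u + orthproj ip V v.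
Proof. by have := orthproj_lin 1 u v; rewrite !scale1r. Qed.

Lemma orthprojB u v :
  orthproj ip V (u - v) = orthproj ip V u - orthproj ip V v.
Proof.
have -> : u - v = -1 *: v + u by rewrite scaleN1r addrC.
by rewrite orthproj_lin scaleN1r addrC.
Qed.

Lemma orthproj_sym u v : ip (orthproj ip V u) v = ip u (orthproj ip V v).
Proof.
rewrite -[RHS]orthproj_ip; last exact: orthproj_in.
by rewrite ipC -orthproj_ip ?ipJ//; exact: orthproj_in.
Qed.

Lemma orthproj_nm u : N (orthproj ip V u) <= N u.
Proof.
have [->|p0] := eqVneq (orthproj ip V u) 0; first by rewrite nm0 nm_ge0.
rewrite -(ler_pM2l (nm_gt0 p0)) -expr2 nm_sq orthproj_ip; last exact: orthproj_in.
by rewrite mulrC ip_cs.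
Qed.

End OrthonormalBasis.

Lemma findim_is_subspace V : findim_subspace V -> is_subspace V.
Proof. by move=> [S _ ->]; exact: lspan_subspace. Qed.

Lemma expansion_subspace k (f : 'I_k -> H) :
  is_subspace [set u | u = \sum_i ip u (f i) *: f i].
Proof.
split => [|c u v /= uE vE].
  by rewrite /= big1// => i _; rewrite ip0l scale0r.
rewrite {1}uE {1}vE scaler_sumr -big_split/=; apply: eq_bigr => i _.
by rewrite ipDl ipZl scalerDl scalerA.
Qed.

Let extend k (f : 'I_k -> H) (e : H) (i : 'I_k.+1) := oapp f e (unlift ord0 i).

Let extend0 k (f : 'I_k -> H) e : extend f e ord0 = e.
Proof. by rewrite /extend unlift_none. Qed.

Let extendS k (f : 'I_k -> H) e i : extend f e (lift ord0 i) = f i.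
Proof. by rewrite /extend liftK. Qed.

(** The Gram-Schmidt step: the component of [e] orthogonal to the span, if
    nonzero, is normalized and added to the basis. *)
Lemma onb_extend (s : set H) e k (f : 'I_k -> H) :
  onb (lspan s) f -> exists k' (f' : 'I_k' -> H), onb (lspan (e |` s)) f'.
Proof.
move=> fs; have Vs := lspan_subspace s; have V's := lspan_subspace (e |` s).
have VV' : lspan s `<=` lspan (e |` s).
  by apply: lspan_sub => // u su; apply: sub_lspan; right.
have V'e : lspan (e |` s) e by apply: sub_lspan; left.
set p := \sum_i ip e (f i) *: f i; set r := e - p.
have Vp : lspan s p by exact: onb_sum.
have rf u : lspan s u -> ip u r = 0.
  move=> su; rewrite ipC /r ipBl /p -(orthproj_onb Vs fs) (orthproj_ip Vs fs)//.
  by rewrite subrr conjc0.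
have [r0|rn0] := eqVneq r 0.
  exists k, f; have <- : lspan s = lspan (e |` s).
    apply/seteqP; split => //; apply: lspan_sub => // u [->|]; last exact: sub_lspan.
    by move/eqP: r0; rewrite subr_eq0 => /eqP ->.
  by [].
set x := (N r)^-1; have Nr := nm_gt0 rn0.
have V'r : lspan (e |` s) r by apply: (subspaceB V's) => //; exact: VV'.
exists k.+1, (extend f (x%:C *: r)); split.
- move=> i; case: (unliftP ord0 i) => [j|] ->.
    by rewrite extendS; apply: VV'; exact: (onb_in fs).
  by rewrite extend0; exact: (subspaceZ _ V's).
- have fr j : ip (f j) (x%:C *: r) = 0.
    by rewrite ipZr rf ?mulr0//; exact: (onb_in fs).
  move=> i j; case: (unliftP ord0 i) => [i'|] ->;
    case: (unliftP ord0 j) => [j'|] ->; rewrite ?extend0 ?extendS.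
  + by rewrite (onb_ip fs) (inj_eq lift_inj).
  + by rewrite fr eq_sym (negbTE (neq_lift _ _)).
  + by rewrite ipC fr conjc0 (negbTE (neq_lift _ _)).
  + rewrite ipZl ipZr conjc_real ipE -!realCM eqxx; congr (_%:C).
    by rewrite /x; field; rewrite gt_eqF.
- apply: lspan_sub; first exact: expansion_subspace.
  have expV u : lspan s u ->
      u = \sum_i ip u (extend f (x%:C *: r) i) *: extend f (x%:C *: r) i.
    move=> su; rewrite big_ord_recl extend0 ipZr rf// mulr0 scale0r add0r.
    by rewrite {1}(onb_expand fs su); apply: eq_bigr => i _; rewrite extendS.
  move=> u [->|su]; last by apply: expV; exact: sub_lspan.
  have -> : e = r + p by rewrite subrK.
  have := proj2 (expansion_subspace (extend f (x%:C *: r))) 1 r p.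
  rewrite scale1r; apply; last exact: expV.
  rewrite /= big_ord_recl extend0 big1 => [|i _]; last first.
    by rewrite extendS ipC rf ?conjc0 ?scale0r//; exact: (onb_in fs).
  rewrite addr0 ipZr conjc_real ipE scalerA -!realCM.
  rewrite (_ : x * _ * x = 1) ?scale1r// /x.
  by field; rewrite gt_eqF.
Qed.

Lemma findim_onb V : findim_subspace V -> exists k (f : 'I_k -> H), onb V f.
Proof.
move=> [_ /finite_seqP[s ->] ->]; elim: s => [|e s [k [f fs]]].
  exists 0%N, (fun=> 0); split => [[]//|[]//|u].
  move=> /(_ [set 0]) u0; rewrite big_ord0; apply: u0; split; last first.
    by move=> v; rewrite /= in_nil.
  by split => // c x y -> ->; rewrite scaler0 addr0.
have -> : [set` e :: s] = e |` [set` s].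
  by apply/seteqP; split => u /=; rewrite in_cons => /predU1P.
exact: onb_extend fs.
Qed.

(** The Gram matrix of [h] in an orthonormal basis of [V] is hermitian; its
    unitary diagonalization is a change of orthonormal basis. *)
Lemma onb_diag V k (f : 'I_k -> H) (h : H -> H -> R[i]) :
  onb V f -> hermitian_on V h ->
  exists (g : 'I_k -> H) (mu : 'I_k -> R), onb V g /\
    forall i u, V u -> h u (g i) = (mu i)%:C * ip u (g i).
Proof.
move=> fV hh; have [Vs _ _] := hh.
pose A := \matrix_(i, j) h (f i) (f j).
have Ah : A \is hermsymmx.
  apply/is_hermitianmxP; rewrite expr0 scale1r; apply/matrixP => i j.
  by rewrite !mxE conjCE (hermJ hh)//; exact: (onb_in fV).
have /mxOverP spr := hermitian_spectral_diag_real Ah.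
have /hermitian_normalmx/orthomx_spectralP := Ah.
set P := spectralmx A; set sp := spectral_diag A => AE.
have Pu : P \is unitarymx by exact: spectral_unitarymx.
have PP : P *m (map_mx Num.conj P^T) = 1%:M by exact/unitarymxP.
have PP' : (map_mx Num.conj P^T) *m P = 1%:M by apply: mulmx1C.
have PA : P *m A *m (map_mx Num.conj P^T) = diag_mx sp.
  by rewrite {1}AE invmx_unitary// !mulmxA PP mul1mx -mulmxA PP mulmx1.
pose g i := \sum_j P i j *: f j.
have Vg i : V (g i) by exact: onb_sum.
have gip i j : ip (f i) (g j) = conjc (P j i).
  by rewrite ipC (onb_coord fV).
have gV : onb V g.
  split => // [i j|u Vu].
    have /matrixP/(_ i j) := PP; rewrite !mxE => <-.
    rewrite ip_suml; apply: eq_bigr => l _.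
    by rewrite ipZl gip !mxE conjCE.
  have fE j : f j = \sum_i ip (f j) (g i) *: g i.
    under eq_bigr => i _.
      rewrite gip /g scaler_sumr; under eq_bigr => l _ do rewrite scalerA.
      over.
    rewrite exchange_big/= (bigD1 j)//= -scaler_suml.
    have E l : \sum_i conjc (P i j) * P i l = (j == l)%:R.
      have /matrixP/(_ j l) := PP'; rewrite !mxE => <-.
      by apply: eq_bigr => i _; rewrite !mxE conjCE.
    rewrite E eqxx scale1r big1 ?addr0// => l lj.
    by rewrite -scaler_suml E eq_sym (negbTE lj) scale0r.
  have Es := expansion_subspace g.
  have EV j : predT j -> [set v | v = \sum_i ip v (g i) *: g i] (ip u (f j) *: f j).
    by move=> _; apply: (subspaceZ _ Es); exact: fE.
  by have := subspace_sum Es EV; rewrite -(onb_expand fV Vu).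
exists g, (fun i => complex.Re (sp 0 i)); split => //.
have hg i j : h (g i) (g j) = (i == j)%:R * (complex.Re (sp 0 i))%:C.
  have /matrixP/(_ i j) := PA; rewrite [RHS]mxE => spE.
  rewrite RRe_real// mulrC mulr_natr -spE mxE.
  have Vc c l : V (c *: f l) by apply: subspaceZ => //; exact: (onb_in fV).
  rewrite /g (herm_sumr hh)//; last exact: onb_sum.
  apply: eq_bigr => l _.
  rewrite (hermZr hh)//; [|exact: (onb_in fV)|exact: onb_sum].
  rewrite !mxE mulrC conjCE; congr (_ * _).
  rewrite (herm_suml hh)//; last exact: (onb_in fV).
  apply: eq_bigr => l' _; rewrite (hermZl hh) ?mxE//; exact: (onb_in fV).
move=> i u Vu; rewrite {1}(onb_expand gV Vu) (herm_suml hh)//; last first.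
  by move=> j; exact: subspaceZ.
rewrite (bigD1 i)//= (hermZl hh)// hg eqxx mul1r mulrC big1 ?addr0// => j ji.
by rewrite (hermZl hh)// hg (negbTE ji) mul0r mulr0.
Qed.

(** [T] multiplies the coordinate of index [i] by [mu i], so the nonzero
    coordinates of an eigenvector all carry the same value of [mu]. *)
Lemma spectral_span_onb W k (f : 'I_k -> H) (mu : 'I_k -> R)
    (T : H -> H) (I : set R) :
  is_subspace W -> onb W f ->
  (forall u, W u -> W (T u) /\ forall i, ip (T u) (f i) = (mu i)%:C * ip u (f i)) ->
  spectral_span (Operator W T) I =
  [set u | W u /\ forall i, ~ I (mu i) -> ip u (f i) = 0].
Proof.
move=> Ws fW TW; apply/seteqP; split.
  apply: lspan_sub.
    split => [|c u v [Wu uf] [Wv vf]].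
      by split => [|i _]; [exact: subspace0|exact: ip0l].
    split=> [|i Ii]; first by case: Ws => _; apply.
    by rewrite ipDl ipZl uf// vf// mulr0 addr0.
  move=> u [x Ix [/= Wu un0 Tu]]; split => // i Ii.
  have [_ /(_ i)] := TW _ Wu; rewrite Tu ipZl => /eqP.
  rewrite -subr_eq0 -mulrBl -realCB mulf_eq0 => /orP[|/eqP//].
  rewrite fmorph_eq0 subr_eq0 => /eqP xmu.
  by rewrite xmu in Ix.
move=> u [Wu uf]; rewrite (onb_expand fW Wu).
apply: subspace_sum => [|i _]; first exact: lspan_subspace.
have [Ii|Ii] := pselect (I (mu i)); last first.
  by rewrite uf// scale0r; exact: (subspace0 (lspan_subspace _)).
apply: (subspaceZ _ (lspan_subspace _)).
apply: sub_lspan; exists (mu i) => //; split => /=; first exact: (onb_in fW).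
  exact: (onb_neq0 fW).
have Wfi := onb_in fW i; have [WT Tf] := TW _ Wfi.
apply: (onb_ext fW) => // [|j]; first exact: subspaceZ.
rewrite Tf ipZl (onb_ip fW); have [->//|ij] := eqVneq i j.
by rewrite !mulr0.
Qed.

Lemma spectral_span_findim W k (f : 'I_k -> H) (mu : 'I_k -> R)
    (T : H -> H) (I : set R) :
  is_subspace W -> onb W f ->
  (forall u, W u -> W (T u) /\ forall i, ip (T u) (f i) = (mu i)%:C * ip u (f i)) ->
  findim_subspace (spectral_span (Operator W T) I).
Proof.
move=> Ws fW TW; rewrite (spectral_span_onb I Ws fW TW).
exists [set f i | i in [set i | I (mu i)]]; first exact: finite_image.
apply/seteqP; split.
  move=> u [Wu uf]; rewrite (onb_expand fW Wu).
  apply: subspace_sum => [|i _]; first exact: lspan_subspace.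
  have [Ii|Ii] := pselect (I (mu i)); last first.
    by rewrite uf// scale0r; exact: (subspace0 (lspan_subspace _)).
  apply: (subspaceZ _ (lspan_subspace _)).
  by apply: sub_lspan; exists i.
apply: lspan_sub.
  split => [|c u v [Wu uf] [Wv vf]].
    by split => [|i _]; [exact: subspace0|exact: ip0l].
  split=> [|i Ii]; first by case: Ws => _; apply.
  by rewrite ipDl ipZl uf// vf// mulr0 addr0.
move=> _ [i /= Ii <-]; split => [|j Ij]; first exact: (onb_in fW).
rewrite (onb_ip fW); have [ij|//] := eqVneq i j.
by rewrite ij in Ii.
Qed.

End InnerProduct.

(** * Lower bounds for symmetric operators *)

Section SymmetricOperators.
Context (R : realType) (H : normedModType R[i]).
Context (ip : H -> H -> R[i]) (ipP : inner_product ip).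
Context (A : operator H) (A_lin : linear_operator A).
Hypothesis A_sym :
  forall u v, op_dom A u -> op_dom A v -> ip (A u) v = ip u (A v).
Implicit Types (u v w : H) (W : set H) (x y t r : R).
Local Notation N := (ip_norm ip).

Definition shifted x u := A u - x%:C *: u.

Lemma op_dom_subspace : is_subspace (op_dom A).
Proof. by case: A_lin. Qed.

Lemma op_linear c u v : op_dom A u -> op_dom A v ->
  A (c *: u + v) = c *: A u + A v.
Proof. by case: A_lin => _; apply. Qed.

Lemma shifted_linear x c u v : op_dom A u -> op_dom A v ->
  shifted x (c *: u + v) = c *: shifted x u + shifted x v.
Proof.
move=> Au Av; rewrite /shifted op_linear// scalerDr opprD scalerBr !scalerA.
by rewrite [c * _]mulrC addrACA.
Qed.

Lemma shifted_sym x u v : op_dom A u -> op_dom A v ->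
  ip (shifted x u) v = ip u (shifted x v).
Proof.
move=> Au Av; rewrite /shifted (ipBl ipP) (ipBr ipP) A_sym//.
by rewrite (ipZl ipP) (ipZr ipP) conjc_real.
Qed.

(** [A - x] has a bounded right inverse on [W]. On the orthogonal complement
    of a sum of eigenspaces this expresses that [x] is a regular value of the
    corresponding part of [A], without introducing that part as an operator on
    another space. *)
Definition solvable_on W x := exists2 C : R, 0 < C &
  forall v, W v ->
    exists w, [/\ W w, op_dom A w, shifted x w = v & N w <= C * N v].

(** For [G := A - x] with [|G u| >= t |u|], the form
    [h(u, v) = <G u, G v> - t^2 <u, v>] is positive, and solving
    [(G - t) (G + t) w = u] gives [h(u, w) = |u|^2] with [h(w, w) <= K |u|^2];
    the Cauchy-Schwarz inequality for [h] then yields [h(u, u) >= |u|^2 / K]. *)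
Lemma lower_bound_improve W x t : is_subspace W ->
  (forall u, W u -> op_dom A u -> t * N u <= N (shifted x u)) -> 0 <= t ->
  solvable_on W (x + t) -> solvable_on W (x - t) ->
  exists2 k : R, 0 < k & forall u, W u -> op_dom A u ->
    (t ^+ 2 + k) * N u ^+ 2 <= N (shifted x u) ^+ 2.
Proof.
move=> Ws lb t0 [C1 C10 S1] [C2 C20 S2].
pose D := W `&` op_dom A.
have Ds : is_subspace D by apply: subspaceI => //; exact: op_dom_subspace.
pose h u v := ip (shifted x u) (shifted x v) - (t ^+ 2)%:C * ip u v.
have hh : hermitian_on D h.
  split => // [c u v w [_ Au] [_ Av] [_ Aw]|u v _ _]; rewrite /h.
    rewrite shifted_linear// (ipDl ipP (c *: shifted x u)) (ipDl ipP (c *: u)).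
    by rewrite !(ipZl ipP); ring.
  by rewrite conjB conjM conjc_real !(ipJ ipP).
have hE u : complex.Re (h u u) = N (shifted x u) ^+ 2 - t ^+ 2 * N u ^+ 2.
  by rewrite /h ReB ReZ !(nm_sq ipP).
have hp : positive_on D h.
  split => // u [Wu Au]; rewrite hE subr_ge0 -exprMn.
  by rewrite ler_sqr ?nnegrE ?nm_ge0 ?mulr_ge0 ?(nm_ge0 ip)// lb.
exists (C1 * C2)^-1; first by rewrite invr_gt0 mulr_gt0.
move=> u Wu Au; rewrite mulrDl -lerBrDl -hE.
have [w1 [Ww1 Aw1 w1E Nw1]] := S1 _ Wu.
have [w [Ww Aw wE Nw]] := S2 _ Ww1.
have Gw1 : shifted x w1 = u + t%:C *: w1.
  by rewrite -w1E /shifted realCD scalerDl opprD addrA subrK.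
have Gw : shifted x w = w1 - t%:C *: w.
  by rewrite -wE /shifted realCB scalerBl opprB addrA addrAC addrK.
have hw z : D z -> h z w = ip z u.
  move=> [Wz Az]; rewrite /h Gw.
  have Aw1tw : op_dom A (w1 - t%:C *: w).
    have As := op_dom_subspace.
    by apply: (subspaceB As) => //; exact: (subspaceZ _ As).
  rewrite shifted_sym//.
  have -> : w1 - t%:C *: w = (- t%:C) *: w + w1 by rewrite scaleNr addrC.
  rewrite shifted_linear// Gw Gw1 scalerBr !scaleNr opprK scalerA -realCM -expr2.
  rewrite [X in ip z X](_ : _ = u + (t ^+ 2)%:C *: w).
    by rewrite (ipDr ipP) (ipZr ipP) conjc_real addrK.
  by rewrite addrC addrA addrK.
have Du : D u by split.
have Dw : D w by split.
have := cauchy_schwarz_sq hp Du Dw; rewrite hw// -(nm_sq ipP).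
have hww : complex.Re (h w w) <= C1 * C2 * N u ^+ 2.
  rewrite hw// (le_trans (ip_cs ipP _ _))// expr2 mulrA ler_wpM2r ?nm_ge0//.
  by rewrite (le_trans Nw)// -mulrA mulrCA ler_pM2l.
have [u0|u0] := eqVneq (N u) 0.
  by move=> _; rewrite u0 expr0n/= mulr0; exact: (herm_ge0 hp).
have Nu : 0 < N u ^+ 2 by rewrite exprn_gt0// lt_neqAle eq_sym u0 nm_ge0.
move=> /le_trans/(_ (ler_wpM2l (herm_ge0 hp Du) hww)).
rewrite [(_ ^+ 2) ^+ 2]expr2 [leRHS]mulrA ler_pM2r// => ?.
by rewrite ler_pdivrMl ?mulr_gt0// mulrC.
Qed.

(** The best constant [s] of such a bound is attained; if [s < r], both
    [x + s] and [x - s] are in the gap and [s] could be improved. *)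
Lemma open_gap_lower_bound W x r : is_subspace W -> 0 <= r ->
  (forall y, `|y - x| < r -> solvable_on W y) ->
  forall u, W u -> op_dom A u -> r * N u <= N (shifted x u).
Proof.
move=> Ws r0 S.
pose E := [set t | 0 <= t <= r /\
  forall u, W u -> op_dom A u -> t * N u <= N (shifted x u)].
have E0 : E 0 by split => [|u _ _]; rewrite ?lexx// mul0r nm_ge0.
have Eub : has_ubound E by exists r => t [/andP[]].
set s := sup E.
have s0 : 0 <= s by apply: ub_le_sup.
have sr : s <= r by apply: ge_sup; [exists 0|move=> t [/andP[]]].
have sE u : W u -> op_dom A u -> s * N u <= N (shifted x u).
  move=> Wu Au; have [u0|u0] := eqVneq (N u) 0; first by rewrite u0 mulr0 nm_ge0.
  have Nu : 0 < N u by rewrite lt_neqAle eq_sym u0 nm_ge0.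
  rewrite -ler_pdivlMr//; apply: ge_sup; first by exists 0.
  by move=> t [_ tE]; rewrite ler_pdivlMr//; exact: tE.
have [->//|s_neq_r] := eqVneq r s.
have s_lt_r : s < r by rewrite lt_neqAle eq_sym s_neq_r.
have [k k0 kE] : exists2 k : R, 0 < k & forall u, W u -> op_dom A u ->
    (s ^+ 2 + k) * N u ^+ 2 <= N (shifted x u) ^+ 2.
  apply: lower_bound_improve => //; apply: S.
    by rewrite addrC addKr ger0_norm.
  by rewrite addrC addKr normrN ger0_norm.
pose s' := Num.min r (Num.sqrt (s ^+ 2 + k)).
have sk : 0 <= s ^+ 2 + k by rewrite addr_ge0 ?sqr_ge0// ltW.
have ss' : s < s'.
  by rewrite lt_min s_lt_r/= -[ltLHS]ger0_norm// -sqrtr_sqr ltr_sqrt// ?ltrDl//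
    ltr_wpDl// sqr_ge0.
suff /(ub_le_sup Eub) : E s' by rewrite leNgt ss'.
have s'0 : 0 <= s' by rewrite (le_trans s0)// ltW.
split; first by rewrite s'0 ge_min lexx.
move=> u Wu Au; rewrite -ler_sqr ?nnegrE ?mulr_ge0 ?nm_ge0// exprMn.
rewrite (le_trans _ (kE u Wu Au))// ler_wpM2r ?sqr_ge0//.
by rewrite -[leRHS]sqr_sqrtr// ler_sqr ?nnegrE ?sqrtr_ge0// ge_min lexx orbT.
Qed.

(** The strict inequality [r < r'] is what makes the iteration on the
    orthogonal complement of a spectral subspace contract. *)
Lemma closed_gap_lower_bound W x r : is_subspace W -> 0 <= r ->
  (forall y, `|y - x| <= r -> solvable_on W y) ->
  exists2 r', r < r' &
    forall u, W u -> op_dom A u -> r' * N u <= N (shifted x u).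
Proof.
move=> Ws r0 S.
have [||k k0 kE] := lower_bound_improve Ws
    (open_gap_lower_bound Ws r0 (fun y yr => S y (ltW yr))) r0.
- by apply: S; rewrite addrC addKr ger0_norm.
- by apply: S; rewrite addrC addKr normrN ger0_norm.
have sk : 0 <= r ^+ 2 + k by rewrite addr_ge0 ?sqr_ge0// ltW.
exists (Num.sqrt (r ^+ 2 + k)).
  by rewrite -[ltLHS]ger0_norm// -sqrtr_sqr ltr_sqrt// ?ltrDl// ltr_wpDl// sqr_ge0.
move=> u Wu Au; rewrite -ler_sqr ?nnegrE ?mulr_ge0 ?nm_ge0 ?sqrtr_ge0//.
by rewrite exprMn sqr_sqrtr// kE.
Qed.

Lemma linear_continuous_bounded (S : {linear H -> H}) : continuous S ->
  exists2 C : R, 0 < C & forall v, N (S v) <= C * N v.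
Proof.
move=> Sc; have /linear_boundedP := @continuous_linear_bounded _ _ _ 0 S (Sc 0).
move=> [M [Mreal MS]].
have /complex_realP[k kE] := Mreal.
exists (`|k| + 1); first by rewrite ltr_wpDl.
move=> v; rewrite -lecR realCM -!(norm_ip ipP); apply: MS.
by rewrite kE ltcR (le_lt_trans (ler_norm _))// ltrDl.
Qed.

Lemma resolvent_solvable x : resolvent_set A x%:C -> solvable_on setT x.
Proof.
move=> [S [Sc S1 _]]; have [C C0 CS] := linear_continuous_bounded Sc.
by exists C => // v _; exists (S v); have [? ?] := S1 v; split.
Qed.

End SymmetricOperators.

(** * Isolated points of the spectrum *)

Section IsolatedPoints.
Context (R : realType) (H : completeNormedModType R[i]).
Context (ip : H -> H -> R[i]) (ipP : inner_product ip).
Implicit Types (u v w k p : H) (x y s e : R).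
Local Notation N := (ip_norm ip).

Lemma geometric_lt (K q e : R) : 0 <= q < 1 -> 0 < e ->
  exists n0, forall n, (n0 <= n)%N -> K * q ^+ n < e.
Proof.
move=> /andP[q0 q1] e0; have /cvg_geometric/cvgrPdist_lt : `|q| < 1.
  by rewrite ger0_norm.
move=> /(_ K _ e0)[n0 _ h]; exists n0 => n /h /=.
by rewrite sub0r normrN; exact/le_lt_trans/ler_norm.
Qed.

(** The limits below are identified by bounding the norm of a difference by
    every term of a geometric sequence. *)
Lemma le_geometric_eq0 (a K q : R) : 0 <= q < 1 -> 0 <= a ->
  (forall n, a <= K * q ^+ n) -> a = 0.
Proof.
move=> q01 a0 aK; apply/eqP; rewrite -(rwP eqP); apply: le_anti; rewrite a0 andbT.
apply/ler_addgt0Pl => e e0; rewrite addr0.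
have [n /(_ _ (leqnn n)) Kn] := geometric_lt K q01 e0.
exact: le_trans (aK n) (ltW Kn).
Qed.

Lemma geometric_limit (u_ : nat -> H) (C q : R) : 0 <= q < 1 ->
  (forall n, N (u_ n.+1 - u_ n) <= C * q ^+ n) ->
  exists p, forall n, N (u_ n - p) <= C / (1 - q) * q ^+ n.
Proof.
move=> q01 uC; have /andP[q0 q1] := q01.
have q1' : 0 < 1 - q by rewrite subr_gt0.
have C0 : 0 <= C by have := le_trans (nm_ge0 _ _) (uC 0%N); rewrite expr0 mulr1.
have uK n j : N (u_ (n + j)%N - u_ n) <= C / (1 - q) * q ^+ n.
  suff : N (u_ (n + j)%N - u_ n) <= C / (1 - q) * (q ^+ n - q ^+ (n + j)).
    move=> /le_trans; apply; rewrite ler_wpM2l ?divr_ge0 ?(ltW q1')//.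
    by rewrite gerBl exprn_ge0.
  elim: j => [|j IH]; first by rewrite addn0 !subrr (nm0 ipP) mulr0.
  rewrite addnS (le_trans (nm_triangle ipP (u_ (n + j)%N) _ _))//.
  rewrite (le_trans (lerD (uC _) IH))// exprS.
  rewrite [leRHS](_ : _ = C * q ^+ (n + j) +
    C / (1 - q) * (q ^+ n - q ^+ (n + j))) ?lexx//.
  by field; rewrite gt_eqF.
have : cvg (u_ @ \oo).
  apply: cauchy_cvg; apply: cauchy_exP => eps eps0.
  have /complex_realP[e eE] : eps \is Num.real by rewrite gtr0_real.
  have e0 : 0 < e by rewrite -ltcR -eE.
  have [n0 n0P] := geometric_lt (C / (1 - q)) q01 e0.
  exists (u_ n0), n0 => // n /= n0n.
  rewrite -ball_normE /ball_/= (norm_ip ipP) eE ltcR (nmC ipP) -(subnKC n0n).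
  exact: le_lt_trans (uK _ _) (n0P _ (leqnn n0)).
move=> /cvg_ex[p up]; exists p => n.
apply/ler_addgt0Pl => e e0.
have /cvgrPdist_lt/(_ e%:C) := up; rewrite ltcR => /(_ e0)[n0 _ n0P].
have := n0P (n0 + n)%N (leq_addr _ _); rewrite /= (norm_ip ipP) ltcR => pe.
rewrite (le_trans (nm_triangle ipP (u_ (n0 + n)%N) _ _))// addrC lerD//.
  by rewrite (nmC ipP) ltW.
by rewrite (nmC ipP) addnC.
Qed.

Section ClosedRange.
Context (D : H -> H).
Hypothesis D_lin : forall c u v, D (c *: u + v) = c *: D u + D v.
Hypothesis D_sym : forall u v, ip (D u) v = ip u (D v).
Hypothesis D_lower :
  forall v, 2^-1 * N (D v) ^+ 2 <= complex.Re (ip (D v) v).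
Hypothesis D_upper :
  forall v, complex.Re (ip (D v) v) <= 3 / 2 * N (D v) ^+ 2.

Let DD u v : D (u + v) = D u + D v.
Proof. by have := D_lin 1 u v; rewrite !scale1r. Qed.

Let D0 : D 0 = 0.
Proof.
by have := DD 0 0; rewrite addr0 => /eqP; rewrite -subr_eq0 opprD addrA subrr
  sub0r oppr_eq0 => /eqP.
Qed.

Let DZ c u : D (c *: u) = c *: D u.
Proof. by have := D_lin c u 0; rewrite D0 !addr0. Qed.

Let DB u v : D (u - v) = D u - D v.
Proof. by rewrite DD -scaleN1r DZ scaleN1r. Qed.

Let D_bounded v : N (D v) <= 2 * N v.
Proof.
have := le_trans (D_lower v) (ip_cs ipP _ _).
have [->|Dv0] := eqVneq (N (D v)) 0; first by rewrite mulr_ge0// nm_ge0.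
have Dv : 0 < N (D v) by rewrite lt_neqAle eq_sym Dv0 nm_ge0.
by rewrite expr2 mulrCA ler_pM2l// mulrC ler_pdivrMr// mulrC.
Qed.

(** The Cauchy-Schwarz inequality for the form [<D u, v>], applied to [v] and
    [D v], shows that zero is isolated in the spectrum of [D]. *)
Let D_below v : N (D v) <= 3 / 2 * N (D (D v)).
Proof.
have [->|Dv0] := eqVneq (N (D v)) 0; first by rewrite mulr_ge0// nm_ge0.
have Dv : 0 < N (D v) ^+ 2 by rewrite exprn_gt0// lt_neqAle eq_sym Dv0 nm_ge0.
pose d u v := ip (D u) v.
have dp : positive_on setT d.
  split; first split=> // [c x y z _ _ _|x y _ _]; rewrite /d.
  - by rewrite D_lin (ipDl ipP) (ipZl ipP).
  - by rewrite D_sym (ipC ipP).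
  - by move=> u _; rewrite (le_trans _ (D_lower u))// mulr_ge0// sqr_ge0.
have := cauchy_schwarz_sq dp (I : setT v) (I : setT (D v)).
rewrite /d -(nm_sq ipP) => h.
have h2 : N (D v) ^+ 2 * N (D v) ^+ 2 <=
    3 / 2 * N (D v) ^+ 2 * (3 / 2 * N (D (D v)) ^+ 2).
  rewrite -expr2 (le_trans h)// ler_pM//.
  - by rewrite (le_trans _ (D_lower v))// mulr_ge0// sqr_ge0.
  - by rewrite (le_trans _ (D_lower _))// mulr_ge0// sqr_ge0.
rewrite -ler_sqr ?nnegrE ?mulr_ge0 ?nm_ge0//.
rewrite -(ler_pM2l Dv) (le_trans h2)// le_eqVlt; apply/orP; left; apply/eqP.
by rewrite exprMn; field.
Qed.

Let B u := u - (2^-1)%:C *: D u.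

Let BD u : B (D u) = D (B u).
Proof. by rewrite /B DB DZ. Qed.

(* a rational number with [q^2 >= 8 / 9], the square of the contraction factor
   of B on the range of D *)
Let q : R := 17 / 18.
Let q01 : 0 <= q < 1. Proof. by rewrite /q; lra. Qed.

Let B_contract v : N (B (D v)) <= q * N (D v).
Proof.
have q0 : 0 <= q by rewrite /q; lra.
rewrite -ler_sqr ?nnegrE ?mulr_ge0 ?nm_ge0// exprMn.
have -> : B (D v) = D v + (- 2^-1)%:C *: D (D v).
  by rewrite /B rmorphN scaleNr.
rewrite (nm_sqD ipP) (nmZr ipP) exprMn real_normK ?num_real//.
rewrite (ipZr ipP) conjc_real ReZ (Re_ipC ipP).
have := D_lower (D v); have := D_below v.
have := nm_ge0 ip (D v); have := nm_ge0 ip (D (D v)).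
by rewrite /q; nra.
Qed.

Let orth v := forall k, D k = 0 -> ip v k = 0.

Let orth_B v : orth v -> orth (B v).
Proof.
move=> vo k Dk; rewrite /B (ipBl ipP) vo// (ipZl ipP) D_sym Dk (ip0r ipP).
by rewrite mulr0 subr0.
Qed.

Let iterBD_le v n : N (D (iter n B v)) <= N (D v) * q ^+ n.
Proof.
elim: n => [|n IH /=]; first by rewrite expr0 mulr1.
rewrite -BD (le_trans (B_contract _))// exprS mulrCA ler_wpM2l//.
by case/andP: q01.
Qed.

(** The iterates [B^n v] of [B = 1 - D / 2] converge geometrically to the
    component of [v] in the kernel of [D], which vanishes here. The factor is
    [18 = 2 * 9], with [9 = (1 / 2) / (1 - q)] from the geometric series and [2]
    a bound of [D]. *)
Let iterB_le v n : orth v -> N (iter n B v) <= 18 * N v * q ^+ n.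
Proof.
move=> vo.
have [j|p pP] := @geometric_limit (fun j => iter j B v) (2^-1 * N (D v)) q q01.
  rewrite /= {1}/B addrAC subrr sub0r (nmN ipP) (nmZr ipP) ger0_norm//.
  by rewrite -mulrA ler_wpM2l// iterBD_le.
have CE : 2^-1 * N (D v) / (1 - q) = 9 * N (D v) by rewrite /q; field.
rewrite CE in pP.
have Dp0 : D p = 0.
  apply: (nm_eq0 ipP).
  apply: (@le_geometric_eq0 _ (18 * N (D v) + N (D v)) q) => // [|j].
    exact: nm_ge0.
  rewrite mulrDl; have -> : D p = D (p - iter j B v) + D (iter j B v).
    by rewrite -DD subrK.
  rewrite (le_trans (nmD ipP _ _))// lerD ?iterBD_le// (le_trans (D_bounded _))//.
  by rewrite (nmC ipP); have := pP j; lra.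
have p0 : p = 0.
  apply: (nm_eq0 ipP); apply/eqP; rewrite -sqrf_eq0; apply/eqP.
  apply: (@le_geometric_eq0 _ (9 * N (D v) * N p) q) => // [|j].
    exact: sqr_ge0.
  have uo : orth (iter j B v) by elim: j => //= j; exact: orth_B.
  rewrite (nm_sq ipP) -[ip p p]subr0 -(uo p Dp0) -(ipBl ipP).
  rewrite (le_trans (ip_cs ipP _ _))// mulrAC ler_wpM2r ?nm_ge0//.
  by rewrite (nmC ipP).
have := pP n; rewrite p0 subr0 => /le_trans; apply.
rewrite ler_wpM2r ?exprn_ge0//; first by case/andP: q01.
by have := D_bounded v; lra.
Qed.

(** A symmetric [D >= 0] with [D^2] comparable to [D] is onto the orthogonal
    complement of its kernel: [sum_n B^n v / 2] is a Neumann series for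
    [D^-1 v]. *)
Lemma comparable_square_solvable v : (forall k, D k = 0 -> ip v k = 0) ->
  exists w, [/\ D w = v, N w <= 162 * N v & forall k, D k = 0 -> ip w k = 0].
Proof.
move=> vo; pose w_ n := \sum_(j < n) (2^-1)%:C *: iter j B v.
have wS n : w_ n.+1 = w_ n + (2^-1)%:C *: iter n B v.
  by rewrite /w_ big_ord_recr.
have [n|w wP] := @geometric_limit w_ (9 * N v) q q01.
  rewrite wS addrC addKr (nmZr ipP) ger0_norm// -ler_pdivlMl ?invr_gt0//.
  by rewrite invrK (le_trans (iterB_le n vo))// mulrA mulrA -natrM.
have CE : 9 * N v / (1 - q) = 162 * N v by rewrite /q; field.
rewrite CE in wP.
have Dw n : D (w_ n) = v - iter n B v.
  elim: n => [|n IH]; first by rewrite /w_ big_ord0 D0 /= subrr.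
  by rewrite wS DD IH DZ /= /B opprB addrA addrAC.
exists w; split.
- apply/eqP; rewrite -subr_eq0; apply/eqP/(nm_eq0 ipP).
  apply: (@le_geometric_eq0 _ (2 * (162 * N v) + 18 * N v) q) => // [|n].
    exact: nm_ge0.
  have -> : D w - v = D (w - w_ n) - iter n B v.
    by rewrite DB Dw opprB addrA addrAC addrK.
  rewrite (le_trans (nmB ipP _ _))// mulrDl lerD ?iterB_le//.
  rewrite (le_trans (D_bounded _))// -mulrA ler_wpM2l//.
  by rewrite (nmC ipP).
- have := wP 0%N; rewrite /w_ big_ord0 sub0r (nmN ipP) expr0 mulr1.
  exact.
- move=> k Dk; apply: modulus_eq0.
  apply: (@le_geometric_eq0 _ (162 * N v * N k) q) => // [|n].
    exact: modulus_ge0.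
  have wo : ip (w_ n) k = 0.
    rewrite /w_ (ip_suml ipP) big1// => j _; rewrite (ipZl ipP).
    have uo : orth (iter j B v) by elim: (nat_of_ord j) => //= i; exact: orth_B.
    by rewrite uo// mulr0.
  rewrite -[ip w k]subr0 -wo -(ipBl ipP) (le_trans (ip_cs_modulus ipP _ _))//.
  by rewrite mulrAC ler_wpM2r ?nm_ge0// (nmC ipP).
Qed.

End ClosedRange.

Section Operator.
Context (A : operator H) (A_lin : linear_operator A).
Hypothesis A_sym :
  forall u v, op_dom A u -> op_dom A v -> ip (A u) v = ip u (A v).

(** With [e = 2 s] and [G := A - x], the gaps [(x, x + 2 s)] and
    [(x - 2 s, x)] give [|G u|^2 >= 2 s |<G u, u>|].
    The bounded operator [D := G (G - s)^-1 = 1 + s (G - s)^-1] thus satisfies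
    [1/2 |D u|^2 <= <D u, u> <= 3/2 |D u|^2], as required by
    [comparable_square_solvable]. *)
Lemma isolated_solvable x e : 0 < e ->
  (forall y, y != x -> `|y - x| < e -> resolvent_set A y%:C) ->
  solvable_on ip A
    [set v | forall k, op_dom A k -> A k = x%:C *: k -> ip v k = 0] x.
Proof.
move=> e0 isoA; have [s s0 se] : exists2 s : R, 0 < s & 2 * s = e.
  by exists (e / 2); [rewrite divr_gt0|field].
have sol y : y != x -> `|y - x| < e -> solvable_on ip A setT y.
  by move=> yx ye; apply: (resolvent_solvable ipP); exact: isoA.
have lb (t : R) : `|t| = s -> forall u, op_dom A u ->
    s * N u <= N (shifted A (x + t) u).
  move=> ts u Au.
  apply: (open_gap_lower_bound ipP A_lin A_sym (@subspaceT _ H) (ltW s0)) => //.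
  move=> y ys; apply: sol.
    by apply: contraTneq ys => ->; rewrite opprD addrA subrr sub0r normrN ts ltxx.
  have -> : y - x = (y - (x + t)) + t by rewrite opprD addrA subrK.
  by rewrite (le_lt_trans (ler_normD _ _))// ts; move: ys; lra.
pose G := shifted A x.
have shE t u : shifted A (x + t) u = G u + (- t)%:C *: u.
  by rewrite /G /shifted realCD scalerDl opprD addrA rmorphN scaleNr.
have lb2 t u : `|t| = s -> op_dom A u ->
    0 <= N (G u) ^+ 2 - 2 * t * complex.Re (ip (G u) u).
  move=> ts Au; have := lb t ts u Au; rewrite shE.
  rewrite -ler_sqr ?nnegrE ?mulr_ge0 ?nm_ge0 ?(ltW s0)//.
  rewrite (nm_sqD ipP) (nmZr ipP) normrN ts (ipZr ipP) conjc_real ReZ; lra.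
have [||S [Sc S1 S2]] := isoA (x + s).
- by rewrite -subr_eq0 addrAC subrr add0r gt_eqF.
- by rewrite addrC addKr gtr0_norm//; lra.
have [C C0 SC] := linear_continuous_bounded ipP Sc.
pose D u := u + s%:C *: S u.
have SA u : op_dom A (S u) by case: (S1 u).
have GS u : G (S u) = D u.
  have [_ SE] := S1 u; rewrite /D -{2}SE /G /shifted realCD scalerDl.
  by rewrite opprD addrA subrK.
have SEu u : u = G (S u) + (- s)%:C *: S u.
  by rewrite GS /D rmorphN scaleNr addrK.
have S_sym u v : ip (S u) v = ip u (S v).
  rewrite {1}(SEu v) {2}(SEu u) -!shE.
  by rewrite (shifted_sym ipP).
have D_lin c u v : D (c *: u + v) = c *: D u + D v.
  rewrite /D linearP/= !scalerDr !scalerA addrACA; congr (_ + (_ + _)).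
  by rewrite mulrC.
have D_sym u v : ip (D u) v = ip u (D v).
  by rewrite /D (ipDl ipP) (ipDr ipP) (ipZl ipP) (ipZr ipP) conjc_real S_sym.
have DRe u : complex.Re (ip (D u) u) =
    N (D u) ^+ 2 - s * complex.Re (ip (D u) (S u)).
  rewrite {2}(SEu u) GS (ipDr ipP) (ipZr ipP) conjc_real ReD ReZ (nm_sq ipP).
  by rewrite mulNr.
have lbp u : 0 <= N (D u) ^+ 2 - 2 * s * complex.Re (ip (D u) (S u)).
  by rewrite -GS; apply: lb2 => //; rewrite gtr0_norm.
have lbn u : 0 <= N (D u) ^+ 2 - 2 * - s * complex.Re (ip (D u) (S u)).
  by rewrite -GS; apply: lb2 => //; rewrite normrN gtr0_norm.
have D_lower u : 2^-1 * N (D u) ^+ 2 <= complex.Re (ip (D u) u).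
  by rewrite DRe; have := lbp u; lra.
have D_upper u : complex.Re (ip (D u) u) <= 3 / 2 * N (D u) ^+ 2.
  by rewrite DRe; have := lbn u; lra.
have kerD k : D k = 0 -> k = (- s)%:C *: S k.
  by rewrite /D => /eqP; rewrite addr_eq0 rmorphN scaleNr => /eqP.
have kerG k : op_dom A k -> A k = x%:C *: k -> S k = (- s^-1)%:C *: k.
  move=> Ak kE; have := S2 _ Ak; rewrite kE -scalerBl -realCB.
  have -> : x - (x + s) = - s by rewrite opprD addrA subrr sub0r.
  rewrite linearZ/= => {2}<-; rewrite scalerA -realCM mulrNN mulVf ?gt_eqF//.
  by rewrite scale1r.
exists (C * 162); first by rewrite mulr_gt0.
move=> v /= vo.
have [k Dk|w [Dw wv wo]] := comparable_square_solvable D_lin D_sym D_lower D_upper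
    (v := v).
  rewrite (kerD k Dk) (ipZr ipP) vo ?mulr0//.
  have := GS k; rewrite Dk /G /shifted => /eqP.
  by rewrite subr_eq0 => /eqP.
exists (S w); split => //.
- move=> k Ak kE; rewrite S_sym (kerG k Ak kE) (ipZr ipP) wo ?mulr0//.
  rewrite /D (kerG k Ak kE) scalerA -realCM mulrN mulfV ?gt_eqF//.
  by rewrite rmorphN rmorph1 scaleN1r subrr.
- by rewrite -/G GS.
- by rewrite (le_trans (SC w))// -mulrA ler_pM2l.
Qed.

End Operator.
End IsolatedPoints.

(** * The part of the spectrum in a compact interval *)

Section SpectralGap.
Context (R : realType) (H : completeNormedModType R[i]).
Context (ip : H -> H -> R[i]) (ipP : inner_product ip).
Context (A : operator H) (A_sa : selfadjoint ip A).
Implicit Types (u v w k : H) (x y : R).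
Local Notation N := (ip_norm ip).

Lemma selfadjoint_linear : linear_operator A.
Proof. by case: A_sa. Qed.

Lemma selfadjoint_sym u v : op_dom A u -> op_dom A v ->
  ip (A u) v = ip u (A v).
Proof.
by move=> Au Av; have [_ _ adj] := A_sa; have [/(_ (conj Av erefl)) + _] := adj v (A v); apply.
Qed.

Definition perp (V : set H) := [set v | forall u, V u -> ip v u = 0].

Lemma perp_subspace V : is_subspace (perp V).
Proof.
split => [u _|c u v uV vV w Vw]; first by rewrite (ip0l ipP).
by rewrite (ipDl ipP) (ipZl ipP) uV// vV// mulr0 addr0.
Qed.

Lemma perp_lspan (S : set H) v :
  (forall u, S u -> ip v u = 0) -> perp (lspan S) v.
Proof.
move=> Sv u; suff : lspan S `<=` [set u | ip v u = 0] by apply.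
apply: lspan_sub => //; split => [|c u1 u2 /= h1 h2]; first exact: (ip0r ipP).
by rewrite /= (ipDr ipP) (ipZr ipP) h1 h2 mulr0 addr0.
Qed.

Lemma eigenvalue_spectrum z u : eigenvector A z u -> spectrum A z.
Proof.
move=> [Au u0 uE] [S [_ _ S2]]; move: (S2 _ Au).
by rewrite uE subrr linear0 => /eqP; rewrite eq_sym (negbTE u0).
Qed.

Context (a b : R).
Hypothesis ess_Delta : real_trace (essential_spectrum A) `&` `[a, b] = set0.
Local Notation Delta := (`[a, b]%classic : set R).
Local Notation eigs := (real_trace (spectrum A) `&` Delta).
Local Notation LDelta := (spectral_span A Delta).

Lemma spectrum_discrete x : eigs x -> discrete_spectrum A x%:C.
Proof.
move=> [sx Dx]; apply: contrapT => nd.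
suff : (real_trace (essential_spectrum A) `&` `[a, b]) x by rewrite ess_Delta.
by [].
Qed.

(** All spectral points of the interval are eigenvalues, and the bound on the
    resolvent at a regular point [x] excludes eigenvalues near [x]. *)
Lemma spectrum_locally_finite x : Delta x ->
  exists2 e : R, 0 < e & forall y, eigs y -> `|y - x| < e -> y = x.
Proof.
move=> Dx; have [rx|sx] := pselect (resolvent_set A x%:C); last first.
  have [[_ [e e0 eP]] _ _] := spectrum_discrete (conj sx Dx).
  exists e => // y [sy _] ye; apply: complexI; apply: eP => //.
  by rewrite -realCB modulusC modulus_real ltcR.
have [S [Sc S1 S2]] := rx; have [C C0 SC] := linear_continuous_bounded ipP Sc.
exists C^-1; first by rewrite invr_gt0.
move=> y ey yx; have [_ [u [Au u0 uE]] _] := spectrum_discrete ey.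
have := SC (A u - x%:C *: u); rewrite S2// uE -scalerBl -realCB (nmZr ipP).
rewrite mulrA ler_pMl ?(nm_gt0 ipP)// leNgt.
by rewrite -(ltr_pM2l C0) mulfV ?gt_eqF// in yx; rewrite yx.
Qed.

Lemma eigs_finite : finite_set eigs.
Proof.
have /choice[e eP] x : exists e : R, Delta x ->
    0 < e /\ forall y, eigs y -> `|y - x| < e -> y = x.
  have [/spectrum_locally_finite[e e0 eP]|nD] := pselect (Delta x).
    by exists e.
  by exists 0.
have := @segment_compact R a b; rewrite compact_cover.
move=> /(_ R Delta (fun x => ball x (e x)))[x Dx| |D' D'D cov].
- exact: ball_open.
- by move=> x Dx; exists x => //; apply: ballxx; exact: (proj1 (eP x Dx)).
apply: sub_finite_set (finite_fset D').
move=> y ey; have [x /= D'x xy] := cov _ (proj2 ey).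
have Dx : Delta x by have := D'D _ D'x; rewrite inE.
have [_ /(_ y ey) ->//] := eP x Dx.
by move: xy; rewrite -ball_normE /ball_/= distrC.
Qed.

Lemma LDelta_findim : findim_subspace LDelta.
Proof.
have /choice[F FP] x : exists F : set H, eigs x -> finite_set F /\
    [set u | op_dom A u /\ A u = x%:C *: u] = lspan F.
  have [/spectrum_discrete[_ _ [F Ff FE]]|nE] := pselect (eigs x).
    by exists F.
  by exists set0.
exists (\bigcup_(x in eigs) F x).
  by apply: bigcup_finite; [exact: eigs_finite|move=> x /FP[]].
apply/seteqP; split; apply: lspan_sub; try exact: lspan_subspace.
  move=> u [x Dx ux]; have ex : eigs x.
    by split => //; exact: eigenvalue_spectrum ux.
  have [_ FE] := FP x ex; have [Au _ uE] := ux.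
  have : lspan (F x) u by rewrite -FE.
  apply: lspan_sub; first exact: lspan_subspace.
  by move=> v Fv; apply: sub_lspan; exists x.
move=> u [x ex Fu]; have [_ FE] := FP x ex.
have [Au uE] : [set u | op_dom A u /\ A u = x%:C *: u] u.
  by rewrite FE; exact: sub_lspan.
have [->|u0] := eqVneq u 0; first exact: (subspace0 (lspan_subspace _)).
by apply: sub_lspan; exists x => //; case: ex.
Qed.

Lemma LDelta_dom : LDelta `<=` op_dom A.
Proof.
apply: lspan_sub; first exact: (op_dom_subspace selfadjoint_linear).
by move=> u [x _ []].
Qed.

Let perp_solution x v w : perp LDelta v -> op_dom A w -> shifted A x w = v ->
  (forall u, eigenvector A x%:C u -> ip w u = 0) -> perp LDelta w.
Proof.
move=> vL Aw wv wx; apply: perp_lspan => u [y Dy uy].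
have [yx|yx] := eqVneq y x; first by apply: wx; rewrite -yx.
have [Au _ uE] := uy.
have : ip v u = 0 by apply: vL; apply: sub_lspan; exists y.
rewrite -wv (shifted_sym ipP selfadjoint_sym)// /shifted uE.
rewrite -scalerBl -realCB (ipZr ipP) conjc_real => /eqP.
by rewrite mulf_eq0 fmorph_eq0 subr_eq0 (negbTE yx) => /eqP.
Qed.

(** The solution of [(A - x) w = v] given by the resolvent, or by
    [isolated_solvable] at an eigenvalue, is orthogonal to the eigenvectors of
    other eigenvalues since [v] is. *)
Lemma perp_LDelta_solvable x : Delta x -> solvable_on ip A (perp LDelta) x.
Proof.
move=> Dx; have [rx|sx] := pselect (resolvent_set A x%:C).
  have [C C0 CP] := resolvent_solvable ipP rx.
  exists C => // v vL; have [w [_ Aw wv wC]] := CP v I.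
  exists w; split => //; apply: (perp_solution vL Aw wv) => u ux.
  by have := eigenvalue_spectrum ux.
have [[_ [e e0 eP]] _ _] := spectrum_discrete (conj sx Dx).
have [|C C0 CP] :=
    isolated_solvable ipP selfadjoint_linear selfadjoint_sym e0 (x := x).
  move=> y yx ye; apply: contrapT => /(eP y%:C).
  rewrite -realCB modulusC modulus_real ltcR => /(_ ye)/complexI/eqP.
  by rewrite (negbTE yx).
exists C => // v vL; have [|w [wo Aw wv wC]] := CP v.
  move=> k Ak kE; have [->|k0] := eqVneq k 0; first exact: (ip0r ipP).
  by apply: vL; apply: sub_lspan; exists x.
exists w; split => //; apply: (perp_solution vL Aw wv) => u [Au _ uE].
exact: wo.
Qed.

Lemma perp_LDelta_lower_bound : a <= b -> exists2 r', (b - a) / 2 < r' &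
  forall u, perp LDelta u -> op_dom A u ->
    r' * N u <= N (shifted A ((a + b) / 2) u).
Proof.
move=> ab; apply: (closed_gap_lower_bound ipP selfadjoint_linear selfadjoint_sym).
- exact: perp_subspace.
- by rewrite divr_ge0// subr_ge0.
move=> y; rewrite ler_norml => yab; apply: perp_LDelta_solvable.
by rewrite /= in_itv/=; move: yab; lra.
Qed.

(** The largest lower bound [s] of the form is a spectral point: if [A - s] had
    a bounded inverse [S], the Cauchy-Schwarz inequality of [q - s] for [u] and
    [S u] would allow to increase [s]. *)
Lemma form_lower_bound (q : qform H) (m : R) : form_of ip A q ->
  is_min (real_trace (spectrum A)) m ->
  forall u, form_dom q u -> m * N u ^+ 2 <= complex.Re (q u u).
Proof.
move=> [_ qs [c cq] _ qA] [_ m_le].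
pose E := [set t | forall u, form_dom q u -> t * N u ^+ 2 <= complex.Re (q u u)].
have Ec : E c.
  by move=> u qu; move: (cq u qu); rewrite lecE ReZ (nm_sq ipP) => /andP[].
move=> u qu; rewrite leNgt; apply/negP => u_lt.
have Nu : 0 < N u ^+ 2.
  rewrite exprn_gt0// lt_neqAle nm_ge0 eq_sym andbT; apply/eqP => Nu0.
  by have := le_lt_trans (Ec u qu) u_lt; rewrite Nu0 expr0n/= !mulr0 ltxx.
have Eub : has_ubound E.
  by exists (complex.Re (q u u) / N u ^+ 2) => t /(_ u qu); rewrite ler_pdivlMr.
set s := sup E.
have sE : E s.
  move=> v qv; have [v0|v0] := eqVneq (N v ^+ 2) 0.
    by rewrite v0 mulr0; have := Ec v qv; rewrite v0 mulr0.
  have Nv : 0 < N v ^+ 2 by rewrite lt_neqAle eq_sym v0 sqr_ge0.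
  rewrite -ler_pdivlMr//; apply: ge_sup; first by exists c.
  by move=> t /(_ v qv); rewrite ler_pdivlMr.
have sm : s < m.
  by rewrite ltNge; apply/negP => ms; have := sE u qu;
    rewrite leNgt (lt_le_trans u_lt)// ler_wpM2r// ltW.
have : resolvent_set A s%:C.
  by apply: contrapT => /(m_le s); rewrite leNgt sm.
move=> /(resolvent_solvable ipP)[C C0 CP].
pose h v w := q v w - s%:C * ip v w.
have [qd ql qc] := qs.
have hp : positive_on (form_dom q) h.
  split; last by move=> v qv; rewrite /h ReB ReZ subr_ge0 -(nm_sq ipP); exact: sE.
  split => // [e v1 v2 v qv1 qv2 qv|v w qv qw]; rewrite /h.
    by rewrite ql// (ipDl ipP) (ipZl ipP); ring.
  by rewrite conjB conjM conjc_real (ipJ ipP) qc.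
suff : E (s + C^-1).
  move=> /(ub_le_sup Eub); rewrite -/s gerDl leNgt invr_gt0.
  by rewrite C0.
move=> v qv; rewrite mulrDl -lerBrDl.
have [w [_ Aw wE wC]] := CP v I.
have qw : form_dom q w by have [/(_ (conj Aw erefl))[]] := qA w (A w).
have hw z : form_dom q z -> h z w = ip z v.
  move=> qz; rewrite -wE /h /shifted (ipBr ipP) (ipZr ipP) conjc_real.
  have [/(_ (conj Aw erefl))[_ /(_ z qz) qwz] _] := qA w (A w).
  by rewrite qc// qwz (ipJ ipP).
have [v0|v0] := eqVneq (N v ^+ 2) 0.
  by rewrite v0 !mulr0 subr0; have := sE v qv; rewrite v0 mulr0.
have Nv : 0 < N v ^+ 2 by rewrite lt_neqAle eq_sym v0 sqr_ge0.
have := cauchy_schwarz_sq hp qv qw; rewrite hw// hw// -(nm_sq ipP).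
have hww : complex.Re (ip w v) <= C * N v ^+ 2.
  by rewrite (le_trans (ip_cs ipP _ _))// expr2 mulrA ler_wpM2r// nm_ge0.
move=> /le_trans/(_ (ler_wpM2l (herm_ge0 hp qv) hww)).
rewrite [(_ ^+ 2) ^+ 2]expr2 [leRHS]mulrA ler_pM2r//.
by rewrite /h ReB ReZ -(nm_sq ipP) ler_pdivrMl// mulrC.
Qed.

End SpectralGap.

(** * Galerkin compressions *)

Section GalerkinSpectral.
Context (R : realType) (H : normedModType R[i]).
Context (ip : H -> H -> R[i]) (ipP : inner_product ip).
Implicit Types (u v w x y z : H).
Local Notation N := (ip_norm ip).

Section Form.
Context (q : qform H) (m : R).
Hypothesis q_herm : hermitian_on (form_dom q) q.
Hypothesis q_lower :
  forall u, form_dom q u -> m * N u ^+ 2 <= complex.Re (q u u).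
Local Notation V := (form_dom q).
Local Notation Na := (ip_norm (form_ip ip q m)).

Lemma Re_form_ip u v : complex.Re (form_ip ip q m u v) =
  complex.Re (q u v) - (m - 1) * complex.Re (ip u v).
Proof. by rewrite /form_ip ReB ReZ. Qed.

Lemma form_dom_subspace : is_subspace V. Proof. by case: q_herm. Qed.

Lemma form_ip_ge u : V u -> N u ^+ 2 <= complex.Re (form_ip ip q m u u).
Proof. by move=> /q_lower; rewrite Re_form_ip -(nm_sq ipP); lra. Qed.

Lemma form_ip_positive : positive_on V (form_ip ip q m).
Proof.
have [Vs ql qc] := q_herm.
split; last by move=> u Vu; rewrite (le_trans _ (form_ip_ge Vu))// sqr_ge0.
split=> // [c u v w Vu Vv Vw|u v Vu Vv]; rewrite /form_ip.
  by rewrite ql// (ipDl ipP) (ipZl ipP); ring.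
by rewrite conjB conjM conjc_real (ipJ ipP) qc.
Qed.

Lemma nm_le_form_norm u : V u -> N u <= Na u.
Proof.
move=> Vu; rewrite -ler_sqr ?nnegrE ?ip_norm_ge0//.
by rewrite (ip_norm_sq form_ip_positive)// form_ip_ge.
Qed.

Lemma form_shift_le (t : R) u v : V u -> V v ->
  complex.Re (q u v) - t * complex.Re (ip u v) <=
  (1 + `|m - 1 - t|) * Na u * Na v.
Proof.
move=> Vu Vv.
have -> : complex.Re (q u v) - t * complex.Re (ip u v) =
    complex.Re (form_ip ip q m u v) +
    complex.Re (ip ((m - 1 - t)%:C *: u) v).
  by rewrite Re_form_ip (ipZl ipP) ReZ; ring.
rewrite -mulrA mulrDl mul1r lerD//; first exact: (cauchy_schwarz form_ip_positive).
rewrite (le_trans (ip_cs ipP _ _))// (nmZr ipP) -mulrA ler_wpM2l//.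
by rewrite ler_pM ?nm_ge0// nm_le_form_norm.
Qed.

Section Diagonalized.
Context (W : set H) k (f : 'I_k -> H) (mu : 'I_k -> R).
Hypothesis (WV : W `<=` V) (Ws : is_subspace W) (fW : onb ip W f).
Hypothesis f_diag : forall i u, W u -> q u (f i) = (mu i)%:C * ip u (f i).

Lemma galerkin_form_expand u v : W u -> W v ->
  q u v = \sum_i (mu i)%:C * (ip u (f i) * conjc (ip v (f i))).
Proof.
move=> Wu Wv; have fV i : V (f i) by apply: WV; exact: (onb_in fW).
rewrite {1}(onb_expand fW Wv) (herm_sumr q_herm)//; last by exact: WV.
  apply: eq_bigr => i _; rewrite (hermZr q_herm)//; last exact: WV.
  by rewrite f_diag// mulrCA [conjc _ * _]mulrC.
by move=> i; apply: (subspaceZ _ form_dom_subspace).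
Qed.

Lemma galerkin_form_sq u : W u ->
  complex.Re (q u u) = \sum_i mu i * modulus (ip u (f i)) ^+ 2.
Proof.
move=> Wu; rewrite galerkin_form_expand// Re_sum; apply: eq_bigr => i _.
by rewrite ReZ -modulus_sq.
Qed.

Lemma galerkin_form_norm_sq u : W u ->
  Na u ^+ 2 = \sum_i (mu i - m + 1) * modulus (ip u (f i)) ^+ 2.
Proof.
move=> Wu; rewrite (ip_norm_sq form_ip_positive); last exact: WV.
rewrite Re_form_ip galerkin_form_sq// -(nm_sq ipP) (onb_nm_sq ipP fW Wu).
by rewrite mulr_sumr -sumrB; apply: eq_bigr => i _; ring.
Qed.

Lemma galerkin_eigenvalue_ge i : m <= mu i.
Proof.
have Wf := onb_in fW i; have := q_lower (WV Wf).
by rewrite f_diag// ReZ (onb_ip fW) eqxx (onb_nm ipP fW) expr1n !mulr1.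
Qed.

Lemma galerkin_operator_coord u : W u ->
  W (galerkin_operator ip q W u) /\
  forall i, ip (galerkin_operator ip q W u) (f i) = (mu i)%:C * ip u (f i).
Proof.
move=> Wu /=; case: xgetP => [w _ [Ww wq]|nw].
  split => // i; rewrite wq ?f_diag//; exact: (onb_in fW).
exfalso; apply: (nw (\sum_i ((mu i)%:C * ip u (f i)) *: f i)).
split => [|v Wv]; first exact: (onb_sum Ws fW).
rewrite galerkin_form_expand// (ip_suml ipP); apply: eq_bigr => i _.
by rewrite (ipZl ipP) (ipJ ipP) mulrA.
Qed.

Lemma galerkin_span (I : set R) :
  spectral_span (galerkin_operator ip q W) I =
  [set u | W u /\ forall i, ~ I (mu i) -> ip u (f i) = 0].
Proof. exact: (spectral_span_onb ipP I Ws fW galerkin_operator_coord). Qed.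

Lemma galerkin_span_findim (I : set R) :
  findim_subspace (spectral_span (galerkin_operator ip q W) I).
Proof. exact: (spectral_span_findim ipP I Ws fW galerkin_operator_coord). Qed.

Section Interval.
Context (a b : R).
Local Notation Delta := (`[a, b]%classic : set R).
Local Notation WDelta := (spectral_span (galerkin_operator ip q W) Delta).

(** The two norms are comparable on Galerkin spectral subspaces with a constant
    independent of the trial space: this turns convergence in the norm of [H]
    into convergence in the form norm. *)
Lemma galerkin_span_form_norm u : WDelta u ->
  Na u <= Num.sqrt `|b - m + 1| * N u.
Proof.
rewrite galerkin_span => -[Wu uf].
rewrite -ler_sqr ?nnegrE ?mulr_ge0 ?sqrtr_ge0 ?ip_norm_ge0// exprMn.
rewrite (sqr_sqrtr (normr_ge0 _)) galerkin_form_norm_sq// (onb_nm_sq ipP fW Wu) mulr_sumr.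
apply: ler_sum => i _; have [|/uf ->] := pselect (Delta (mu i)).
  rewrite /= in_itv/= => /andP[_ mub]; rewrite ler_wpM2r ?sqr_ge0//.
  by rewrite (le_trans _ (ler_norm _))// lerD2r lerB.
by rewrite /modulus normr0 expr0n/= !mulr0.
Qed.

(** The compression of [A - (a + b) / 2] maps the spectral subspace to itself;
    its norm, at most the half-width of the interval, is the factor gained in
    each step of [LnDelta_orthogonal]. *)
Lemma galerkin_span_centered u : WDelta u ->
  exists u', [/\ WDelta u', N u' <= (b - a) / 2 * N u &
    forall y, W y -> q u y - ((a + b) / 2)%:C * ip u y = ip u' y].
Proof.
rewrite galerkin_span => -[Wu uf].
pose c := (a + b) / 2.
exists (\sum_i ((mu i - c)%:C * ip u (f i)) *: f i).
have Wu' := onb_sum Ws fW (fun i => (mu i - c)%:C * ip u (f i)).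
split.
- by split => // i /uf uf0; rewrite (onb_coord ipP fW) uf0 mulr0.
- have [ab|ba] := leP a b; last first.
    have uf0 i : ip u (f i) = 0.
      by apply: uf; rewrite /= in_itv/= => /andP[h1 h2]; have := le_trans h1 h2; rewrite leNgt ba.
    have -> : u = 0.
      by rewrite (onb_expand fW Wu) big1// => i _; rewrite uf0 scale0r.
    rewrite big1 ?(nm0 ipP) ?mulr0// => i _.
    by rewrite (ip0l ipP) mulr0 scale0r.
  rewrite -ler_sqr ?nnegrE ?mulr_ge0 ?nm_ge0 ?subr_ge0// exprMn.
  rewrite (onb_nm_sq ipP fW Wu) (onb_nm_sq ipP fW Wu') mulr_sumr.
  apply: ler_sum => i _; rewrite (onb_coord ipP fW) modulusM modulus_real exprMn.
  have [|/uf ->] := pselect (Delta (mu i)).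
    rewrite /= in_itv/= => /andP[amu mub]; rewrite ler_wpM2r ?sqr_ge0//.
    rewrite ler_sqr ?nnegrE ?divr_ge0 ?subr_ge0//.
    by rewrite ler_norml /c; apply/andP; split; lra.
  by rewrite /modulus normr0 expr0n/= !mulr0.
- move=> y Wy; rewrite galerkin_form_expand// (onb_parseval ipP fW u Wy).
  rewrite mulr_sumr -sumrB (ip_suml ipP); apply: eq_bigr => i _.
  by rewrite (ipZl ipP) realCB -mulrBl mulrA (ipJ ipP).
Qed.

(** Testing the residual [(A_n - lam) z], which is of the size of [z - u],
    against the part [w] of [z] outside the interval, with the sign of each
    component below [lam] reversed, gives [|w|_a^2 = O(|z - u|_a |w|_a)]. *)
Lemma galerkin_span_approx (lam : R) u z : a < lam < b -> m <= lam ->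
  V u -> (forall v, V v -> q u v = lam%:C * ip u v) -> W z ->
  exists2 x, WDelta x &
    Na (z - x) <= (1 + `|m - 1 - lam|) /
      Num.min ((b - lam) / (b - m + 1)) ((lam - a) / (lam - m + 1)) * Na (z - u).
Proof.
move=> /andP[alam lamb] mlam Vu uE Wz.
set kap := Num.min _ _.
have bm : 0 < b - m + 1 by lra.
have lm : 0 < lam - m + 1 by lra.
have kap0 : 0 < kap by rewrite lt_min !divr_gt0 ?subr_gt0.
pose d i := if `[< Delta (mu i) >] then 0 else ip z (f i).
pose w := \sum_i d i *: f i.
pose y := \sum_i ((Num.sg (mu i - lam))%:C * d i) *: f i.
have Ww : W w by exact: (onb_sum Ws fW).
have Wy : W y by exact: (onb_sum Ws fW).
have wc i : ip w (f i) = d i by rewrite (onb_coord ipP fW).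
have yc i : ip y (f i) = (Num.sg (mu i - lam))%:C * d i.
  by rewrite (onb_coord ipP fW).
have out i : ~ Delta (mu i) -> mu i < a \/ b < mu i.
  move=> nD; have [amu|] := leP a (mu i); last by left.
  by have [mub|] := leP (mu i) b; [case: nD; rewrite /= in_itv/= amu mub|right].
exists (z - w).
  rewrite galerkin_span; split => [|i nD]; first exact: (subspaceB Ws).
  by rewrite (ipBl ipP) wc /d asboolF// subrr.
have -> : z - (z - w) = w by rewrite opprB addrCA subrr addr0.
have Nay : Na y = Na w.
  apply/eqP; rewrite -(@eqrXn2 _ 2)// ?ip_norm_ge0//.
  rewrite !galerkin_form_norm_sq//; apply/eqP; apply: eq_bigr => i _.
  rewrite yc wc modulusM exprMn modulus_real real_normK ?num_real//.
  rewrite /d; case: asboolP => [_|/out mui].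
    by rewrite /modulus normr0 expr0n/= !mulr0.
  rewrite sqr_sg subr_eq0; suff -> : mu i != lam by rewrite mul1r.
  by apply/eqP => mulam; case: mui; rewrite mulam; lra.
have key : kap * Na w ^+ 2 <= complex.Re (q z y) - lam * complex.Re (ip z y).
  rewrite galerkin_form_norm_sq// galerkin_form_expand//.
  rewrite (onb_parseval ipP fW z Wy) !Re_sum !mulr_sumr -sumrB.
  apply: ler_sum => i _; rewrite ReZ -mulrBl yc wc /d.
  case: asboolP => [_|/out mui].
    by rewrite mulr0 conjc0 mulr0 /modulus normr0 expr0n/= !mulr0.
  rewrite conjM conjc_real [X in complex.Re X]mulrCA ReZ -modulus_sq.
  rewrite [complex.Re _]/= [leRHS]mulrA [leLHS]mulrA ler_wpM2r ?sqr_ge0//.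
  rewrite [leRHS]mulrC -normrEsg.
  have mmu := galerkin_eigenvalue_ge i.
  case: mui => [mua|bmu].
    rewrite ltr0_norm ?subr_lt0; last by lra.
    have k1 : kap * (lam - m + 1) <= lam - a.
      by rewrite -ler_pdivlMr// ge_min lexx orbT.
    have : kap * (mu i - m + 1) <= kap * (lam - m + 1) by rewrite ler_pM2l//; lra.
    lra.
  rewrite gtr0_norm ?subr_gt0; last by lra.
  have k1 : kap <= (b - lam) / (b - m + 1) by rewrite ge_min lexx.
  have m1 : 0 <= mu i - m + 1 by lra.
  rewrite (le_trans (ler_wpM2r m1 k1))// mulrAC ler_pdivrMr//.
  rewrite -subr_ge0.
  have -> : (mu i - lam) * (b - m + 1) - (b - lam) * (mu i - m + 1) =
    (mu i - b) * (lam - m + 1) by ring.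
  by rewrite mulr_ge0//; lra.
have Vz : V z by exact: WV.
have Vy : V y by exact: WV.
have E : complex.Re (q z y) - lam * complex.Re (ip z y) =
    complex.Re (q (z - u) y) - lam * complex.Re (ip (z - u) y).
  by rewrite (hermBl q_herm)// (ipBl ipP) uE// !ReB ReZ; ring.
have Vzu : V (z - u) by exact: (subspaceB form_dom_subspace).
have := le_trans key; rewrite E => /(_ _ (form_shift_le lam Vzu Vy)).
rewrite Nay => h; have [->|w0] := eqVneq (Na w) 0.
  by rewrite mulr_ge0 ?ip_norm_ge0// divr_ge0// ?addr_ge0// ltW.
have Naw : 0 < Na w by rewrite lt_neqAle eq_sym w0 ip_norm_ge0.
move: h; rewrite expr2 mulrA ler_pM2r// => h.
by rewrite mulrAC ler_pdivlMr// mulrC.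
Qed.

End Interval.
End Diagonalized.

Lemma galerkin_diag W : W `<=` V -> findim_subspace W ->
  exists k (f : 'I_k -> H) (mu : 'I_k -> R), [/\ is_subspace W, onb ip W f &
    forall i u, W u -> q u (f i) = (mu i)%:C * ip u (f i)].
Proof.
move=> WV Wf; have Ws := findim_is_subspace Wf.
have [k [f fW]] := findim_onb ipP Wf.
have [g [mu [gW gmu]]] := onb_diag ipP fW (hermitian_onS Ws WV q_herm).
by exists k, g, mu.
Qed.

End Form.
End GalerkinSpectral.

(** * Gaps and approximation *)

Section Gap.
Context (R : realType) (H : lmodType R[i]).
Implicit Types (g : H -> H -> R[i]) (V X Y : set H) (u v x : H).

Definition approximable g (X : nat -> set H) u := forall e : R, 0 < e ->
  \forall n \near \oo, exists2 x, X n x & ip_norm g (u - x) <= e.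

Lemma approximable_subspace V g (X : nat -> set H) : positive_on V g ->
  (forall n, is_subspace (X n)) -> (forall n, X n `<=` V) ->
  is_subspace [set u | V u /\ approximable g X u].
Proof.
move=> gV Xs XV; have [[Vs _ _] _] := gV; split => [|c u v [Vu uX] [Vv vX]].
  split; first exact: subspace0.
  move=> e e0; near=> n; exists 0; first exact: subspace0.
  by rewrite subr0 (ip_norm0 gV) ltW.
split; first by case: Vs => _; apply.
move=> e e0; have c0 : 0 < modulus c + 1 by rewrite ltr_wpDl ?modulus_ge0.
have e1 : 0 < e / (modulus c + 1) / 2 by rewrite !divr_gt0.
have e2 : 0 < e / 2 by rewrite divr_gt0.
move: (uX _ e1) (vX _ e2); apply: filterS2 => n [x Xx ux] [y Xy vy].
exists (c *: x + y); first by case: (Xs n) => _; apply.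
have Vux : V (u - x) by apply: subspaceB => //; exact: XV Xx.
have Vvy : V (v - y) by apply: subspaceB => //; exact: XV Xy.
have -> : c *: u + v - (c *: x + y) = c *: (u - x) + (v - y).
  by rewrite scalerBr opprD addrACA.
rewrite (le_trans (ip_normD gV _ _))//; first exact: subspaceZ.
rewrite (ip_normZ gV)// [leRHS]splitr lerD//.
have c1 := modulus_ge0 c.
rewrite (le_trans (ler_wpM2l c1 ux))// mulrA ler_pdivrMr// divfK//.
rewrite mulrCA -[leRHS]mulr1 ler_wpM2l ?(ltW e0)// ler_pdivrMr// mul1r.
by rewrite lerDl.
Unshelve. all: by end_near. Qed.

Lemma gap_bounds g X Y (e : R) : 0 <= e ->
  (forall u, X u -> ip_norm g u = 1 -> exists2 y, Y y & ip_norm g (u - y) <= e) ->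
  0 <= gap g X Y <= e.
Proof.
move=> e0 XY; rewrite /gap; set S := [set _ | _ in _].
have Se s : S s -> 0 <= s <= e.
  move=> [u [Xu u1] <-]; have [y Yy uy] := XY u Xu u1.
  apply/andP; split.
    apply: lb_le_inf; first by exists (ip_norm g (u - y)), y.
    by move=> _ [z _ <-]; exact: sqrtr_ge0.
  rewrite (le_trans _ uy)//; apply: ge_inf; last by exists y.
  by exists 0 => _ [z _ <-]; exact: sqrtr_ge0.
have [->|/set0P[s Ss]] := eqVneq S set0; first by rewrite sup0 lexx.
have Sub : has_ubound S by exists e => t /Se/andP[].
have /andP[s0 se] := Se s Ss.
rewrite (le_trans s0 (ub_le_sup Sub Ss))/=.
by apply: ge_sup; [exists s|move=> t /Se/andP[]].
Qed.

Lemma gap_hat_cvg0 g (X : nat -> set H) Y :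
  (forall e : R, 0 < e -> \forall n \near \oo, forall u, X n u ->
     ip_norm g u = 1 -> exists2 y, Y y & ip_norm g (u - y) <= e) ->
  (forall e : R, 0 < e -> \forall n \near \oo, forall u, Y u ->
     ip_norm g u = 1 -> exists2 x, X n x & ip_norm g (u - x) <= e) ->
  gap_hat g (X n) Y @[n --> \oo] --> (0 : R).
Proof.
move=> XY YX; apply/cvgrPdist_le => e e0.
move: (XY _ e0) (YX _ e0); apply: filterS2 => n h1 h2.
have /andP[g1 g1e] := gap_bounds (ltW e0) h1.
have /andP[g2 g2e] := gap_bounds (ltW e0) h2.
rewrite sub0r normrN ger0_norm /gap_hat; last by rewrite le_max g1.
by rewrite ge_max g1e g2e.
Qed.

End Gap.

Section UniformApproximation.
Context (R : realType) (H : normedModType R[i]).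
Context (ip : H -> H -> R[i]) (ipP : inner_product ip).
Local Notation N := (ip_norm ip).

Lemma approximable_uniform V g (X : nat -> set H) (E : set H) k (f : 'I_k -> H) :
  positive_on V g -> (forall n, is_subspace (X n)) -> (forall n, X n `<=` V) ->
  E `<=` V -> onb ip E f -> (forall i, approximable g X (f i)) ->
  forall e : R, 0 < e -> \forall n \near \oo, forall u, E u ->
    exists2 x, X n x & ip_norm g (u - x) <= e * N u.
Proof.
move=> gV Xs XV EV fE fX e e0; have [[Vs _ _] _] := gV.
have k0 : 0 < (k%:R + 1 : R) by rewrite ltr_wpDl.
have : \forall n \near \oo, forall i, exists2 x, X n x &
    ip_norm g (f i - x) <= e / (k%:R + 1).
  by apply: filter_forall => i; apply: fX; rewrite divr_gt0.
apply: filterS => n h u Eu.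
have /choice[x xP] i : exists x, X n x /\ ip_norm g (f i - x) <= e / (k%:R + 1).
  by have [x Xx xf] := h i; exists x.
exists (\sum_i ip u (f i) *: x i).
  apply: subspace_sum => // i _; apply: subspaceZ => //.
  by case: (xP i).
have Vfx i : V (f i - x i).
  apply: subspaceB => //; first by apply: EV; exact: (onb_in fE).
  by apply: (XV n); case: (xP i).
rewrite {1}(onb_expand fE Eu) -sumrB.
under eq_bigr => i _ do rewrite -scalerBr.
rewrite (le_trans (ip_norm_sum gV _))//; first by move=> i; exact: subspaceZ.
rewrite (@le_trans _ _ (\sum_(i < k) (N u * (e / (k%:R + 1)))))//.
  apply: ler_sum => i _; rewrite (ip_normZ gV)// ler_pM ?modulus_ge0 ?ip_norm_ge0//.
    exact: (onb_coord_le ipP fE).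
  by case: (xP i).
rewrite sumr_const card_ord -[leLHS]mulr_natl mulrCA mulrC ler_wpM2r ?nm_ge0//.
rewrite mulrCA -[leRHS]mulr1 ler_wpM2l ?(ltW e0)// ler_pdivrMr// mul1r.
by rewrite lerDl.
Qed.

Lemma orthproj_sum V k (f : 'I_k -> H) (I : finType) (F : I -> H) :
  is_subspace V -> onb ip V f ->
  orthproj ip V (\sum_i F i) = \sum_i orthproj ip V (F i).
Proof.
move=> Vs fV; apply: (big_morph _ (orthprojD ipP Vs fV)).
by apply: (orthproj_eq0 ipP Vs fV) => v _; exact: (ip0l ipP).
Qed.

Lemma orthprojZ V k (f : 'I_k -> H) c u :
  is_subspace V -> onb ip V f ->
  orthproj ip V (c *: u) = c *: orthproj ip V u.
Proof.
move=> Vs fV; have := orthproj_lin ipP Vs fV c u 0; rewrite !addr0.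
by rewrite (orthproj_id ipP Vs fV (subspace0 Vs)) addr0.
Qed.

Lemma orthproj_best V k (f : 'I_k -> H) u v :
  is_subspace V -> onb ip V f -> V v -> N (u - orthproj ip V u) <= N (u - v).
Proof.
move=> Vs fV Vv; rewrite -ler_sqr ?nnegrE ?nm_ge0//.
have -> : u - v = (u - orthproj ip V u) + (orthproj ip V u - v).
  by rewrite addrA subrK.
rewrite [leRHS](nm_sqD ipP) (orthproj_orth ipP Vs fV); last first.
  by apply: subspaceB => //; exact: (orthproj_in ipP Vs fV).
by rewrite mulr0 addr0 lerDl sqr_ge0.
Qed.

(** ** Spectral subspaces of symmetric operators in finite dimension *)

Section Coordinates.
Context (W : set H) k (f : 'I_k -> H) (th : 'I_k -> R) (T : H -> H) (I : set R).
Hypotheses (Ws : is_subspace W) (fW : onb ip W f).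
Hypothesis TW : forall u, W u ->
  W (T u) /\ forall i, ip (T u) (f i) = (th i)%:C * ip u (f i).
Local Notation span := (spectral_span (Operator W T) I).

Lemma spectral_span_preimage (d : R) x : 0 < d ->
  (forall i, I (th i) -> d <= th i) -> span x ->
  exists y, [/\ W y, T y = x & N y <= d^-1 * N x].
Proof.
move=> d0 Id; rewrite (spectral_span_onb ipP I Ws fW TW) => -[Wx xf].
pose y := \sum_i ((th i)^-1%:C * ip x (f i)) *: f i.
have Wy : W y by exact: (onb_sum Ws fW).
have yc i : ip y (f i) = (th i)^-1%:C * ip x (f i) by rewrite (onb_coord ipP fW).
have d1 : 0 <= d^-1 by rewrite invr_ge0 ltW.
exists y; split => //.
  have [WTy Ty] := TW Wy; apply: (onb_ext fW) => // i; rewrite Ty yc.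
  have [Ii|Ii] := pselect (I (th i)); last by rewrite xf// !mulr0.
  rewrite mulrA -realCM mulfV ?mul1r//.
  by rewrite gt_eqF// (lt_le_trans d0)// Id.
rewrite -ler_sqr ?nnegrE ?mulr_ge0 ?nm_ge0// exprMn.
rewrite (onb_nm_sq ipP fW Wy) (onb_nm_sq ipP fW Wx) mulr_sumr.
apply: ler_sum => i _; rewrite yc modulusM modulus_real exprMn.
have [Ii|Ii] := pselect (I (th i)); last first.
  by rewrite xf// /modulus normr0 expr0n/= !mulr0.
have thd := Id i Ii; have th0 := lt_le_trans d0 thd.
rewrite ler_wpM2r ?sqr_ge0// ger0_norm ?invr_ge0 ?(ltW th0)//.
by rewrite ler_sqr ?nnegrE ?invr_ge0 ?(ltW th0) ?(ltW d0)// lef_pV2.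
Qed.

(** [x'] is [x] without its components outside of [I], on which [T - t] is
    bounded below by [d]. *)
Lemma spectral_span_residual (d t : R) x : 0 < d ->
  (forall i, ~ I (th i) -> d <= `|th i - t|) -> W x ->
  exists2 x', span x' & d * N (x - x') <= N (T x - t%:C *: x).
Proof.
move=> d0 Id Wx.
pose x' := \sum_i (if `[< I (th i) >] then ip x (f i) else 0) *: f i.
have Wx' : W x' by exact: (onb_sum Ws fW).
have xc i : ip x' (f i) = if `[< I (th i) >] then ip x (f i) else 0.
  by rewrite (onb_coord ipP fW).
exists x'.
  rewrite (spectral_span_onb ipP I Ws fW TW); split => // i nI.
  by rewrite xc asboolF.
have [WTx Tx] := TW Wx.
rewrite -ler_sqr ?nnegrE ?mulr_ge0 ?nm_ge0 ?(ltW d0)// exprMn.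
have Wxx' : W (x - x') by exact: subspaceB.
have WTt : W (T x - t%:C *: x) by apply: subspaceB => //; exact: subspaceZ.
rewrite (onb_nm_sq ipP fW Wxx') (onb_nm_sq ipP fW WTt) mulr_sumr.
apply: ler_sum => i _; rewrite !(ipBl ipP) (ipZl ipP) Tx xc -mulrBl -realCB.
rewrite modulusM modulus_real exprMn; case: asboolP => [Ii|nI].
  by rewrite subrr /modulus normr0 expr0n/= mulr0 mulr_ge0 ?sqr_ge0.
rewrite subr0 ler_wpM2r ?sqr_ge0// ler_sqr ?nnegrE ?(ltW d0)//.
exact: Id.
Qed.

End Coordinates.
End UniformApproximation.

(** * Convergence of the Galerkin spectral subspaces *)

Section Convergence.
Context (R : realType) (H : completeNormedModType R[i]).
Context (ip : H -> H -> R[i]) (ipP : inner_product ip).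
Context (A : operator H) (A_sa : selfadjoint ip A).
Context (q : qform H) (qA : form_of ip A q).
Context (m : R) (m_min : is_min (real_trace (spectrum A)) m).
Context (a b : R) (lt_ab : a < b).
Context (rho_a : resolvent_set A a%:C) (rho_b : resolvent_set A b%:C).
Hypothesis ess_Delta : real_trace (essential_spectrum A) `&` `[a, b] = set0.
Context (L_ : nat -> set H).
Hypothesis L_findim : forall n, findim_subspace (L_ n).
Hypothesis L_sub : forall n, L_ n `<=` form_dom q.
Hypothesis L_approx : forall u, form_dom q u ->
  exists u_ : nat -> H, (forall n, L_ n (u_ n)) /\
    ip_norm (form_ip ip q m) (u - u_ n) @[n --> \oo] --> (0 : R).
Implicit Types (u v w x y z : H).
Local Notation N := (ip_norm ip).
Local Notation ga := (form_ip ip q m).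
Local Notation Na := (ip_norm (form_ip ip q m)).
Local Notation V := (form_dom q).
Local Notation Delta := (`[a, b]%classic : set R).
Local Notation LDelta := (spectral_span A Delta).
Local Notation LnDelta := (fun n => spectral_span (galerkin_operator ip q (L_ n)) Delta).
Local Notation K := (Num.sqrt `|b - m + 1|).

Lemma form_hermitian : hermitian_on V q.
Proof. by case: qA. Qed.

Let q_herm := form_hermitian.
Let q_lower : forall u, V u -> m * N u ^+ 2 <= complex.Re (q u u).
Proof. exact: (form_lower_bound ipP qA m_min). Qed.
Let gaP : positive_on V ga := form_ip_positive ipP q_herm q_lower.
Let Vs : is_subspace V := form_dom_subspace q_herm.

Lemma op_form u v : op_dom A u -> V v -> V u /\ q u v = ip (A u) v.
Proof.
move=> Au Vv; have [_ _ _ _ /(_ u (A u))[/(_ (conj Au erefl))[Vu h] _]] := qA.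
by split => //; exact: h.
Qed.

Lemma op_dom_form : op_dom A `<=` V.
Proof. by move=> u Au; have [] := op_form Au (subspace0 Vs). Qed.

Lemma LDelta_form : LDelta `<=` V.
Proof. by move=> u /(LDelta_dom A_sa)/op_dom_form. Qed.

Lemma LnDelta_sub n : LnDelta n `<=` L_ n.
Proof.
apply: lspan_sub; first exact: findim_is_subspace.
by move=> u [t _ []].
Qed.

Lemma LnDelta_form n : LnDelta n `<=` V.
Proof. by move=> u /LnDelta_sub/L_sub. Qed.

Lemma LnDelta_subspace n : is_subspace (LnDelta n).
Proof. exact: lspan_subspace. Qed.

Lemma LnDelta_findim n : findim_subspace (LnDelta n).
Proof.
have [k [f [mu [Ws fW fd]]]] :=
  galerkin_diag ipP q_herm (@L_sub n) (L_findim n).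
exact: (galerkin_span_findim ipP q_herm (@L_sub n) Ws fW fd).
Qed.

Lemma LnDelta_form_norm n u : LnDelta n u -> Na u <= K * N u.
Proof.
have [k [f [mu [Ws fW fd]]]] :=
  galerkin_diag ipP q_herm (@L_sub n) (L_findim n).
exact: (galerkin_span_form_norm ipP q_herm q_lower (@L_sub n) Ws fW fd).
Qed.

Lemma L_approximable u : V u -> approximable ga L_ u.
Proof.
move=> Vu e e0; have [u_ [Lu uu]] := L_approx Vu.
move/cvgrPdist_le : uu => /(_ e e0); apply: filterS => n.
rewrite sub0r normrN ger0_norm ?ip_norm_ge0// => ue.
by exists (u_ n).
Qed.

Lemma LDelta_approximable u : LDelta u -> approximable ga LnDelta u.
Proof.
suff : LDelta `<=` [set u | V u /\ approximable ga LnDelta u].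
  by move=> h /h[].
apply: lspan_sub.
  apply: approximable_subspace => //; [exact: LnDelta_subspace|exact: LnDelta_form].
move=> {}u [t Dt ut]; have [Au u0 uE] := ut.
have st : spectrum A t%:C := eigenvalue_spectrum ut.
have Vu := op_dom_form Au; split => // e e0.
have mt : m <= t by case: m_min => _; apply.
have tab : a < t < b.
  move: Dt; rewrite /= in_itv/= => /andP[at_ tb].
  rewrite !lt_neqAle at_ tb !andbT; apply/andP; split.
    by apply: contraPneq st => <-; rewrite /spectrum/= notE.
  by apply: contraPneq st => ->; rewrite /spectrum/= notE.
have qu v : V v -> q u v = t%:C * ip u v.
  by move=> Vv; have [_ ->] := op_form Au Vv; rewrite uE (ipZl ipP).
pose C := (1 + `|m - 1 - t|) / Num.min ((b - t) / (b - m + 1)) ((t - a) / (t - m + 1)).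
have C0 : 0 <= C.
  case/andP: tab => at_ tb; apply: divr_ge0; first by rewrite addr_ge0.
  by rewrite le_min; apply/andP; split; apply: divr_ge0; lra.
have C1 : 0 < 1 + C by rewrite ltr_pwDl.
have e1 : 0 < e / (1 + C) by rewrite divr_gt0.
have := L_approximable Vu e1; apply: filterS => n [z Lz uz].
have [k [f [mu [Ws fW fd]]]] :=
  galerkin_diag ipP q_herm (@L_sub n) (L_findim n).
have [x xD zx] := galerkin_span_approx ipP q_herm q_lower (@L_sub n) Ws fW fd
  tab mt Vu qu Lz.
exists x => //; have Vz := L_sub Lz; have Vx := LnDelta_form xD.
have -> : u - x = (u - z) + (z - x) by rewrite addrA subrK.
rewrite (le_trans (ip_normD gaP _ _))//; [exact: subspaceB|exact: subspaceB|].
move: zx; rewrite -/C (ip_normB gaP Vz Vu) => zx.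
have := uz; rewrite ler_pdivlMr// => h.
by rewrite (le_trans (lerD (lexx _) zx))// -{1}[Na (u - z)]mul1r -mulrDl mulrC.
Qed.

(** For [v] orthogonal to the spectral subspace write [v = (A - c) w], where
    [c] is the midpoint of the interval, [r] its half-width and
    [|w| <= |v| / r'] with [r' > r]. Up to a vanishing error, [<x, v>] is
    [<(A_n - c) x, w>] with [|(A_n - c) x| <= r |x|], so that each step gains
    the factor [r / r' < 1]. *)
Lemma LnDelta_orthogonal v : perp ip LDelta v -> forall e : R, 0 < e ->
  \forall n \near \oo, forall x, LnDelta n x ->
    complex.Re (ip x v) <= e * N x.
Proof.
pose c := (a + b) / 2; pose r := (b - a) / 2.
have ab := lt_ab.
have r0 : 0 <= r by rewrite /r; lra.
have Dc : Delta c by rewrite /= in_itv/= /c; apply/andP; split; lra.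
have [r' rr' lb] := perp_LDelta_lower_bound ipP A_sa ess_Delta (ltW lt_ab).
rewrite -/c -/r in rr' lb.
have r'0 : 0 < r' by exact: le_lt_trans rr'.
have [C' _ sol] := perp_LDelta_solvable ipP A_sa ess_Delta Dc.
pose rho := r / r'.
have rho01 : 0 <= rho < 1.
  by rewrite divr_ge0 ?(ltW r'0)//= ltr_pdivrMr// mul1r.
have step k : forall v, perp ip LDelta v -> forall e : R, 0 < e ->
    \forall n \near \oo, forall x, LnDelta n x ->
      complex.Re (ip x v) <= (rho ^+ k * N v + e) * N x.
  elim: k => [|k IH] {}v vL e e0.
    near=> n => x _; rewrite expr0 mul1r (le_trans (ip_cs ipP _ _))//.
    by rewrite mulrC ler_wpM2r ?nm_ge0// lerDl ltW.
  have [w [wL Aw wv _]] := sol v vL.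
  have wle : r * N w <= rho * N v.
    rewrite /rho [leRHS]mulrAC -[leRHS]mulrA ler_wpM2l// ler_pdivlMr// mulrC -wv.
    exact: lb.
  have Vw := op_dom_form Aw.
  pose C0 := (1 + `|m - 1 - c|) * K.
  have C00 : 0 <= C0 by rewrite mulr_ge0 ?sqrtr_ge0// addr_ge0.
  have d10 : 0 < 2 * (r + 1) by lra.
  have d20 : 0 < 2 * (r + C0 + 1) by lra.
  have [e1 e10 e1E] : exists2 t : R, 0 < t & r * t <= e / 2.
    exists (e / (2 * (r + 1))); first by rewrite divr_gt0.
    have := divfK (lt0r_neq0 d10) e.
    have : 0 < e / (2 * (r + 1)) by rewrite divr_gt0.
    nra.
  have [e2 e20 e2E] : exists2 t : R, 0 < t & (r + C0) * t <= e / 2.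
    exists (e / (2 * (r + C0 + 1))); first by rewrite divr_gt0.
    have := divfK (lt0r_neq0 d20) e.
    have : 0 < e / (2 * (r + C0 + 1)) by rewrite divr_gt0.
    nra.
  move: (IH w wL _ e10) (L_approximable Vw e20).
  apply: filterS2 => n IHn [z Lz wz] x xD.
  have [k' [f [mu [Ws fW fd]]]] :=
    galerkin_diag ipP q_herm (@L_sub n) (L_findim n).
  have [x' [x'D x'x x'E]] :=
    galerkin_span_centered ipP q_herm (@L_sub n) Ws fW fd xD.
  have Vx := LnDelta_form xD; have Vz := L_sub Lz.
  have Vwz : V (w - z) by exact: subspaceB.
  have E1 : complex.Re (ip x v) =
      complex.Re (q x w) - c * complex.Re (ip x w).
    have [_ qwx] := op_form Aw Vx.
    rewrite (Re_hermC q_herm Vx Vw) qwx (Re_ipC ipP) -wv /shifted (ipBl ipP).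
    by rewrite (ipZl ipP) ReB ReZ (Re_ipC ipP w).
  have E2 : complex.Re (q x z) - c * complex.Re (ip x z) = complex.Re (ip x' z).
    by rewrite -x'E// ReB ReZ.
  have E3 : complex.Re (ip x v) = complex.Re (ip x' w) +
      complex.Re (ip x' (z - w)) +
      (complex.Re (q x (w - z)) - c * complex.Re (ip x (w - z))).
    rewrite E1 (hermBr q_herm)// !(ipBr ipP) !ReB; move: E2; lra.
  have i1 := IHn x' x'D.
  have i2 := ip_cs ipP x' (z - w).
  have i3 := form_shift_le ipP q_herm q_lower c Vx Vwz.
  have i4 : N (z - w) <= e2.
    by rewrite (nmC ipP) (le_trans (nm_le_form_norm ipP q_herm q_lower Vwz)).
  have i5 : (1 + `|m - 1 - c|) * Na x * Na (w - z) <= C0 * N x * e2.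
    rewrite ler_pM ?mulr_ge0 ?ip_norm_ge0 ?addr_ge0//.
    by rewrite /C0 -mulrA ler_wpM2l ?addr_ge0//; exact: LnDelta_form_norm xD.
  have i6 : N x' * N (z - w) <= r * N x * e2.
    by rewrite ler_pM ?nm_ge0.
  have i7 : (rho ^+ k * N w + e1) * N x' <= (rho ^+ k * N w + e1) * (r * N x).
    rewrite ler_wpM2l// addr_ge0 ?mulr_ge0 ?nm_ge0 ?(ltW e10)//.
    by rewrite exprn_ge0//; case/andP: rho01.
  have i8 : rho ^+ k * (r * N w) <= rho ^+ k * (rho * N v).
    by rewrite ler_wpM2l// exprn_ge0//; case/andP: rho01.
  have Nx := nm_ge0 ip x.
  have i9 : (rho ^+ k * (r * N w) + r * e1 + (r + C0) * e2) * N x <=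
      (rho ^+ k * (rho * N v) + e) * N x.
    by rewrite ler_wpM2r//; lra.
  rewrite exprSr -mulrA E3; move: i1 i2 i3 i5 i6 i7 i9; lra.
move=> vL e e0; have e2 : 0 < e / 2 by rewrite divr_gt0.
have [k /(_ _ (leqnn k)) kP] := geometric_lt (N v) rho01 e2.
have := step k v vL _ e2; apply: filterS => n h x /h /le_trans; apply.
by rewrite ler_wpM2r ?nm_ge0// [leRHS]splitr lerD2r mulrC ltW.
Unshelve. all: by end_near. Qed.

Local Notation E := (orthproj ip LDelta).
Local Notation Q n := (orthproj ip (LnDelta n)).

Let LDs : is_subspace LDelta := lspan_subspace _.

(** The Galerkin spectral projections converge strongly: spurious eigenvectors
    may exist for every [n], but by [LnDelta_orthogonal] they converge weakly to
    zero. *)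
Lemma orthproj_LnDelta_cvg p (e : R) : 0 < e ->
  \forall n \near \oo, N (Q n p - E p) <= e.
Proof.
move=> e0; have e3 : 0 < e / 3 by rewrite divr_gt0.
have [k [g gE]] := findim_onb ipP (LDelta_findim ipP ess_Delta).
have pE : perp ip LDelta (p - E p).
  by move=> u uL; rewrite (orthproj_orth ipP LDs gE).
have EpL : LDelta (E p) by exact: (orthproj_in ipP LDs gE).
move: (LDelta_approximable EpL e3) (LnDelta_orthogonal pE e3).
apply: filterS2 => n [z zD Ez] orth.
have Ds := @LnDelta_subspace n; have [l [f fD]] := findim_onb ipP (LnDelta_findim n).
have VEz : V (E p - z).
  by apply: subspaceB => //; [exact: LDelta_form|exact: LnDelta_form zD].
have NEz : N (E p - z) <= e / 3.
  exact: le_trans (nm_le_form_norm ipP q_herm q_lower VEz) Ez.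
set y := Q n p - z.
have yD : LnDelta n y by apply: (subspaceB Ds) => //; exact: (orthproj_in ipP Ds fD).
have Ny : N y <= 2 * (e / 3).
  have [->|y0] := eqVneq y 0; first by rewrite (nm0 ipP) mulr_ge0// ltW.
  rewrite -(ler_pM2r (nm_gt0 ipP y0)) -expr2 (nm_sq ipP) {1}/y (ipBl ipP).
  rewrite (orthproj_ip ipP Ds fD)// -(ipBl ipP).
  have -> : p - z = (E p - z) + (p - E p) by rewrite [RHS]addrC addrA subrK.
  rewrite (ipDl ipP) ReD [complex.Re (ip (p - E p) y)](Re_ipC ipP).
  have := orth y yD; have := ip_cs ipP (E p - z) y.
  have := ler_wpM2r (nm_ge0 ip y) NEz; lra.
rewrite (le_trans (nm_triangle ipP z _ _))// (nmC ipP z).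
by rewrite (le_trans (lerD Ny NEz))//; lra.
Qed.

Context (L : set H) (L_fd : findim_subspace L).
Local Notation P := (orthproj ip L).

(** Composing with the finite-rank projection [P], on either side, upgrades the
    strong convergence to convergence in norm. *)
Lemma orthproj_finite_rank_cvg (e : R) : 0 < e -> \forall n \near \oo,
  (forall y, N (Q n (P y) - E (P y)) <= e * N y) /\
  (forall x, LnDelta n x -> N (P (x - E x)) <= e * N x).
Proof.
move=> e0; have Ls := findim_is_subspace L_fd.
have [l [g gL]] := findim_onb ipP L_fd.
have [k [f fE]] := findim_onb ipP (LDelta_findim ipP ess_Delta).
have l0 : 0 < (l%:R + 1 : R) by rewrite ltr_wpDl.
have el : 0 < e / (l%:R + 1) by rewrite divr_gt0.
have sume (t : R) : 0 <= t -> \sum_(i < l) t * (e / (l%:R + 1)) <= e * t.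
  move=> t0; rewrite sumr_const card_ord -[leLHS]mulr_natl mulrCA mulrC.
  rewrite ler_wpM2r// mulrCA -[leRHS]mulr1 ler_wpM2l ?(ltW e0)//.
  by rewrite ler_pdivrMr// mul1r lerDl.
have : \forall n \near \oo, forall i : 'I_l,
    N (Q n (g i) - E (g i)) <= e / (l%:R + 1).
  by apply: filter_forall => i; exact: orthproj_LnDelta_cvg.
apply: filterS => n h.
have Ds := @LnDelta_subspace n; have [d [fn fD]] := findim_onb ipP (LnDelta_findim n).
split => [y|x xD].
  rewrite (orthproj_onb ipP Ls gL y) (orthproj_sum ipP _ Ds fD).
  rewrite (orthproj_sum ipP _ LDs fE) -sumrB (le_trans (nm_sum ipP _))//.
  rewrite (le_trans _ (sume _ (nm_ge0 _ _)))// ler_sum// => i _.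
  rewrite (orthprojZ ipP _ _ Ds fD) (orthprojZ ipP _ _ LDs fE) -scalerBr.
  rewrite (nmZ ipP) ler_pM ?modulus_ge0 ?nm_ge0//.
  exact: (onb_coord_le ipP gL).
rewrite (orthproj_onb ipP Ls gL) (le_trans (nm_sum ipP _))//.
rewrite (le_trans _ (sume _ (nm_ge0 _ _)))// ler_sum// => i _.
rewrite (nmZ ipP) (onb_nm ipP gL) mulr1 (ipBl ipP) (orthproj_sym ipP LDs fE).
rewrite -{1}(orthproj_id ipP Ds fD xD) (orthproj_sym ipP Ds fD) -(ipBr ipP).
rewrite (le_trans (ip_cs_modulus ipP _ _))// ler_wpM2l ?nm_ge0//.
Qed.

(** ** The subspaces selected by the compressions *)

Context (gamma : R) (gamma0 : 0 < gamma).
Local Notation M := (fun n => spectral_span (Operator (LnDelta n) (Q n \o P))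
  `[gamma / 2, 1]%classic).

Lemma compression_diag n : exists k (f : 'I_k -> H) (th : 'I_k -> R),
  [/\ onb ip (LnDelta n) f, forall i, th i <= 1 &
    forall u, LnDelta n u -> LnDelta n ((Q n \o P) u) /\
      forall i, ip ((Q n \o P) u) (f i) = (th i)%:C * ip u (f i)].
Proof.
have Ds := @LnDelta_subspace n; have [d [fn fD]] := findim_onb ipP (LnDelta_findim n).
have Ls := findim_is_subspace L_fd; have [l [g gL]] := findim_onb ipP L_fd.
have hP : hermitian_on (LnDelta n) (fun u v => ip (P u) v).
  split => // [c u v w _ _ _|u v _ _].
    by rewrite (orthproj_lin ipP Ls gL) (ipDl ipP) (ipZl ipP).
  by rewrite (orthproj_sym ipP Ls gL) (ipC ipP).
have [f [th [fO fth]]] := onb_diag ipP fD hP.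
exists d, f, th; split => // [i|u uD].
  have := fth i (f i) (onb_in fO i); rewrite (ipE ipP) (onb_nm ipP fO).
  move=> /(congr1 (@complex.Re R)); rewrite ReZ /= expr1n mulr1 => <-.
  rewrite (le_trans (ip_cs ipP _ _))// (onb_nm ipP fO) mulr1.
  by rewrite (le_trans (orthproj_nm ipP Ls gL _))// (onb_nm ipP fO).
split => [|i]; first exact: (orthproj_in ipP Ds fD).
rewrite /= (orthproj_ip ipP Ds fD) ?fth//; exact: (onb_in fO).
Qed.

Lemma M_sub n : M n `<=` LnDelta n.
Proof.
apply: lspan_sub; first exact: LnDelta_subspace.
by move=> u [t _ []].
Qed.

Lemma M_subspace n : is_subspace (M n).
Proof. exact: lspan_subspace. Qed.

Lemma M_form n : M n `<=` V.
Proof. by move=> u /M_sub/LnDelta_form. Qed.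

Lemma M_findim n : findim_subspace (M n).
Proof.
have [k [f [th [fD _ fT]]]] := compression_diag n.
exact: (spectral_span_findim ipP _ (@LnDelta_subspace n) fD fT).
Qed.

(** An element [x] of [M n] is [Q P y] with [|y| <= (2 / gamma) |x|], and [Q P y]
    is close to [E P y]. *)
Lemma M_near_LDelta (e : R) : 0 < e -> \forall n \near \oo,
  forall x, M n x -> exists2 v, LDelta v & N (x - v) <= e * N x.
Proof.
move=> e0; have g2 : 0 < gamma / 2 by rewrite divr_gt0.
have [k [g gE]] := findim_onb ipP (LDelta_findim ipP ess_Delta).
have := orthproj_finite_rank_cvg (mulr_gt0 e0 g2).
apply: filterS => n [QP _] x xM.
have [d [f [th [fD _ fT]]]] := compression_diag n.
have [|y [yD yx Ny]] := spectral_span_preimage ipP (@LnDelta_subspace n) fD fT g2 _ xM.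
  by move=> i; rewrite /= in_itv/= => /andP[].
exists (E (P y)); first exact: (orthproj_in ipP LDs gE).
rewrite -{1}yx (le_trans (QP y))// -mulrA ler_wpM2l ?(ltW e0)//.
by rewrite mulrC -ler_pdivlMr// mulrC.
Qed.

(** An approximation [z] of the eigenvector [u] from the Galerkin spectral
    subspace is an approximate eigenvector of [Q P] for [t >= gamma], so that its
    components with eigenvalues below [gamma / 2] are small. *)
Lemma eigenvector_approximable u (t : R) : LDelta u -> gamma <= t ->
  E (P u) = t%:C *: u -> approximable ip M u.
Proof.
move=> uL gt uE e e0; have g2 : 0 < gamma / 2 by rewrite divr_gt0.
have Ls := findim_is_subspace L_fd; have [l [gl gL]] := findim_onb ipP L_fd.
have [k [g gE]] := findim_onb ipP (LDelta_findim ipP ess_Delta).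
pose c := gamma / 2; pose D := c + N u + t + 2.
have D0 : 0 < D by rewrite /D; have := nm_ge0 ip u; rewrite /c; lra.
(* the residual of z below is at most d (N z + 1 + t) *)
pose d := Num.min 1 (Num.min 1 c * e / D).
have c1 : 0 < Num.min 1 c by rewrite lt_min ltr01.
have d0 : 0 < d by rewrite lt_min ltr01 divr_gt0// mulr_gt0.
have d1 : d <= 1 by rewrite ge_min lexx.
have dD : d * D <= c * e.
  rewrite (@le_trans _ _ (Num.min 1 c * e / D * D))//.
    by rewrite ler_wpM2r ?(ltW D0)// ge_min lexx orbT.
  by rewrite divfK ?gt_eqF// ler_wpM2r ?(ltW e0)// ge_min lexx orbT.
move: (orthproj_finite_rank_cvg d0) (LDelta_approximable uL d0).
apply: filterS2 => n [QP _] [z zD uz].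
have Vuz : V (u - z).
  by apply: subspaceB => //; [exact: LDelta_form|exact: LnDelta_form zD].
have Nuz : N (u - z) <= d.
  exact: le_trans (nm_le_form_norm ipP q_herm q_lower Vuz) uz.
have [k' [f [th [fD th1 fT]]]] := compression_diag n.
have [|x xM zx] := spectral_span_residual ipP (@LnDelta_subspace n) fD fT
    (I := `[gamma / 2, 1]%classic) (t := t) g2 _ zD.
  move=> i; rewrite /= in_itv/= => /negP; rewrite th1 andbT -ltNge => thi.
  by rewrite distrC (le_trans _ (ler_norm _))//; lra.
exists x => //.
have Nz : N z <= N u + d.
  have -> : z = u - (u - z) by rewrite opprB addrCA subrr addr0.
  by rewrite (le_trans (nmB ipP _ _))// lerD2l.
have res : N ((Q n \o P) z - t%:C *: z) <= d * N z + d + t * d.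
  have -> : (Q n \o P) z - t%:C *: z = (Q n (P z) - E (P z)) +
      (E (P (z - u)) + t%:C *: (u - z)).
    rewrite (orthprojB ipP Ls gL) (orthprojB ipP LDs gE) uE scalerBr.
    have -> : E (P z) - t%:C *: u + (t%:C *: u - t%:C *: z) =
        E (P z) - t%:C *: z by rewrite addrA subrK.
    by rewrite addrA subrK.
  rewrite (le_trans (nmD ipP _ _))// -addrA lerD//.
  rewrite (le_trans (nmD ipP _ _))// lerD//.
    rewrite (le_trans (orthproj_nm ipP LDs gE _))//.
    by rewrite (le_trans (orthproj_nm ipP Ls gL _))// (nmC ipP).
  have t0 : 0 <= t by lra.
  by rewrite (nmZr ipP) ger0_norm// ler_wpM2l.
have cux : c * N (u - x) <= d * D.
  have t1 := nm_triangle ipP z u x.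
  have h1 : c * N (u - x) <= c * N (u - z) + c * N (z - x).
    by rewrite -mulrDr ler_wpM2l// ltW.
  have h2 : c * N (u - z) <= c * d by rewrite ler_wpM2l// ltW.
  have h3 : d * N z <= d * (N u + 1).
    by rewrite ler_wpM2l ?(ltW d0)// (le_trans Nz)// lerD2l.
  move: zx res; rewrite /D -/c; lra.
by rewrite -(ler_pM2l g2) -/c (le_trans cux).
Qed.

Context k (g : 'I_k -> H) (th : 'I_k -> R).
Hypothesis gE : onb ip LDelta g.
Hypothesis g_ge : forall i, gamma <= th i.
Hypothesis g_eig : forall i, E (P (g i)) = (th i)%:C *: g i.

Let MT n : M n `<=` setT. Proof. by []. Qed.

Lemma M_uniform (e : R) : 0 < e -> \forall n \near \oo,
  forall u, LDelta u -> exists2 x, M n x & N (u - x) <= e * N u.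
Proof.
apply: (approximable_uniform ipP (ip_positive ipP) M_subspace MT _ gE) => //.
by move=> i; apply: (eigenvector_approximable (onb_in gE i) (g_ge i) (g_eig i)).
Qed.

Let K0 : 0 <= K. Proof. exact: sqrtr_ge0. Qed.

Lemma LnDelta_uniform (e : R) : 0 < e -> \forall n \near \oo,
  forall u, LDelta u -> exists2 x, LnDelta n x & Na (u - x) <= e * N u.
Proof.
apply: (approximable_uniform ipP gaP LnDelta_subspace LnDelta_form LDelta_form gE).
by move=> i; apply: LDelta_approximable; exact: (onb_in gE).
Qed.

(** On [LnDelta n] the two norms are comparable, uniformly in [n]: closeness
    in [H] to an element that is form-approximated from [LnDelta n] implies
    closeness in the form norm. *)
Lemma M_form_uniform (e : R) : 0 < e -> \forall n \near \oo,
  forall u, LDelta u -> exists2 x, M n x & Na (u - x) <= e * N u.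
Proof.
move=> e0; have K1 : 0 < 1 + 2 * K by have := K0; lra.
have d0 : 0 < e / (1 + 2 * K) by rewrite divr_gt0.
move: (M_uniform d0) (LnDelta_uniform d0); apply: filterS2 => n h1 h2 u uL.
have [x xM ux] := h1 u uL; have [z zD uz] := h2 u uL; exists x => //.
have Vu := LDelta_form uL; have Vz := LnDelta_form zD; have Vx := M_form xM.
have Vuz : V (u - z) by exact: subspaceB.
have zxD : LnDelta n (z - x).
  by apply: (subspaceB (@LnDelta_subspace n)) => //; exact: M_sub.
have -> : u - x = (u - z) + (z - x) by rewrite addrA subrK.
rewrite (le_trans (ip_normD gaP Vuz _))//; first exact: LnDelta_form zxD.
have h3 := LnDelta_form_norm zxD.
have h4 := nm_triangle ipP u z x.
have h5 := nm_le_form_norm ipP q_herm q_lower Vuz.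
have h6 : K * N (z - x) <= K * (2 * (e / (1 + 2 * K) * N u)).
  by rewrite ler_wpM2l// (le_trans h4)// (nmC ipP z); lra.
have -> : e * N u = (1 + 2 * K) * (e / (1 + 2 * K) * N u).
  by rewrite mulrA mulrCA mulfV ?gt_eqF// mulr1.
move: uz h3 h6; lra.
Qed.

Lemma M_form_near_LDelta (e : R) : 0 < e -> \forall n \near \oo,
  forall x, M n x -> exists2 v, LDelta v & Na (x - v) <= e * N x.
Proof.
move=> e0; have K1 : 0 < 3 * K + 2 by have := K0; lra.
pose d := Num.min 1 (e / (3 * K + 2)).
have d0 : 0 < d by rewrite lt_min ltr01 divr_gt0.
have d1 : d <= 1 by rewrite ge_min lexx.
have de : (3 * K + 2) * d <= e.
  by rewrite -ler_pdivlMl// mulrC ge_min lexx orbT.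
move: (M_near_LDelta d0) (LnDelta_uniform d0); apply: filterS2 => n h1 h2 x xM.
have [v vL xv] := h1 x xM; have [z zD vz] := h2 v vL; exists v => //.
have Vv := LDelta_form vL; have Vz := LnDelta_form zD; have Vx := M_form xM.
have Vvz : V (v - z) by exact: subspaceB.
have xzD : LnDelta n (x - z).
  by apply: (subspaceB (@LnDelta_subspace n)) => //; exact: M_sub.
have -> : x - v = (x - z) + (z - v) by rewrite addrA subrK.
rewrite (le_trans (ip_normD gaP (LnDelta_form xzD) _))//; first exact: subspaceB.
rewrite (ip_normB gaP Vz Vv).
have h3 := LnDelta_form_norm xzD.
have h4 := nm_triangle ipP v x z.
have h5 := nm_le_form_norm ipP q_herm q_lower Vvz.
have Nx := nm_ge0 ip x.
have Nv : N v <= 2 * N x.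
  have -> : v = x - (x - v) by rewrite opprB addrCA subrr addr0.
  rewrite (le_trans (nmB ipP _ _))//.
  have := le_trans xv (ler_wpM2r Nx d1); lra.
have h7 : d * N v <= d * (2 * N x) by rewrite ler_wpM2l// ltW.
have h6 : K * N (x - z) <= K * (3 * (d * N x)).
  by rewrite ler_wpM2l//; lra.
have h8 : (3 * K + 2) * d * N x <= e * N x by rewrite ler_wpM2r.
move: vz h3 h6 h7 h8; lra.
Qed.

Lemma M_gap_cvg : gap_hat ip (M n) LDelta @[n --> \oo] --> (0 : R).
Proof.
apply: gap_hat_cvg0 => e e0.
  by have := M_near_LDelta e0; apply: filterS => n h x /h[v vL xv] x1; exists v;
    rewrite // (le_trans xv)// x1 mulr1.
by have := M_uniform e0; apply: filterS => n h x /h[v vL xv] x1; exists v;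
  rewrite // (le_trans xv)// x1 mulr1.
Qed.

Lemma M_form_gap_cvg : gap_hat ga (M n) LDelta @[n --> \oo] --> (0 : R).
Proof.
apply: gap_hat_cvg0 => e e0.
  have := M_form_near_LDelta e0; apply: filterS => n h x xM x1.
  have [v vL xv] := h x xM; exists v => //; rewrite (le_trans xv)//.
  rewrite -[leRHS]mulr1 ler_wpM2l ?(ltW e0)// -x1.
  exact: (nm_le_form_norm ipP q_herm q_lower (M_form xM)).
have := M_form_uniform e0; apply: filterS => n h x xL x1.
have [v vL xv] := h x xL; exists v => //; rewrite (le_trans xv)//.
rewrite -[leRHS]mulr1 ler_wpM2l ?(ltW e0)// -x1.
exact: (nm_le_form_norm ipP q_herm q_lower (LDelta_form xL)).
Qed.

End Convergence.

(** * Convergence of Galerkin eigenvalues *)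

Section Hausdorff.
Context (R : realType).
Implicit Types (S T : set R).

Lemma hausdorff_dist_bounds S T (e : R) :
  0 <= e -> (forall x, S x -> exists2 y, T y & `|x - y| <= e) ->
  (forall y, T y -> exists2 x, S x & `|y - x| <= e) ->
  (0 <= hausdorff_dist S T <= e%:E)%E.
Proof.
move=> e0 ST TS; rewrite /hausdorff_dist le_max lexx/= !ge_max lee_fin e0/=.
suff ex (X Y : set R) : (forall x, X x -> exists2 y, Y y & `|x - y| <= e) ->
    (ereal_sup [set ereal_inf [set `|x - y|%R%:E | y in Y] | x in X] <= e%:E)%E.
  by rewrite !ex.
move=> XY; apply: ge_ereal_sup => _ [x Xx <-]; have [y Yy xy] := XY x Xx.
rewrite (@le_trans _ _ `|x - y|%:E) ?lee_fin//.
by apply: ge_ereal_inf; exists `|x - y|%:E => //; exists y.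
Qed.

Lemma hausdorff_cvg0 (S : nat -> set R) T :
  (forall e : R, 0 < e -> \forall n \near \oo, forall x, S n x ->
     exists2 y, T y & `|x - y| <= e) ->
  (forall e : R, 0 < e -> \forall n \near \oo, forall y, T y ->
     exists2 x, S n x & `|y - x| <= e) ->
  hausdorff_dist (S n) T @[n --> \oo] --> 0%E.
Proof.
move=> ST TS; apply/fine_cvgP; split.
  move: (ST 1 ltr01) (TS 1 ltr01); apply: filterS2 => n h1 h2.
  have /andP[d0 d1] := hausdorff_dist_bounds ler01 h1 h2.
  by rewrite ge0_fin_numE// (le_lt_trans d1)// ltry.
apply/cvgrPdist_le => e e0.
move: (ST _ e0) (TS _ e0); apply: filterS2 => n h1 h2.
have /andP[d0 d1] := hausdorff_dist_bounds (ltW e0) h1 h2.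
rewrite sub0r normrN/= ger0_norm ?fine_ge0// -lee_fin fineK//.
by rewrite ge0_fin_numE// (le_lt_trans d1)// ltry.
Qed.

End Hausdorff.

Section GalerkinEigenvalues.
Context (R : realType) (H : normedModType R[i]).
Context (ip : H -> H -> R[i]) (ipP : inner_product ip).
Context (q : qform H) (m : R).
Hypothesis q_herm : hermitian_on (form_dom q) q.
Hypothesis q_lower :
  forall u, form_dom q u -> m * ip_norm ip u ^+ 2 <= complex.Re (q u u).
Local Notation N := (ip_norm ip).
Local Notation Na := (ip_norm (form_ip ip q m)).
Local Notation V := (form_dom q).
Context (K : R) (K0 : 0 <= K).
Context (E : set H) (Es : is_subspace E) (EV : E `<=` V).
Context (k : nat) (g : 'I_k -> H) (la : 'I_k -> R).
Hypotheses (gE : onb ip E g)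
  (g_eig : forall j v, V v -> q (g j) v = (la j)%:C * ip (g j) v).
Implicit Types (X : set H) (u v x y z : H).

Let Vs : is_subspace V := form_dom_subspace q_herm.

(** If every [lambda_j] is far from the Galerkin eigenvalue of [x], testing
    against the combination of the [g j] whose coefficients are those of [x]
    with the sign of [lambda_j - mu] bounds the projection of [x] on [E]. *)
Lemma galerkin_eigenvalue_near X (e d mu : R) :
  is_subspace X -> X `<=` V -> (forall x, X x -> Na x <= K * N x) ->
  (forall x, X x -> exists2 v, E v & Na (x - v) <= d * N x) ->
  (forall u, E u -> exists2 x, X x & Na (u - x) <= d * N u) ->
  0 <= d <= 2^-1 -> (1 + K ^+ 2) * K * d < e / 4 ->
  galerkin_spectrum ip q X mu -> exists j, `|mu - la j| <= e.
Proof.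
move=> Xs XV XK near unif /andP[d0 d1] de [x [Xx x0 xmu]].
apply: contrapT => noj.
have far j : e < `|la j - mu|.
  by rewrite distrC ltNge; apply/negP => h; apply: noj; exists j.
have Vx := XV _ Xx; have Nx := nm_gt0 ipP x0.
have e0 : 0 <= e.
  have : 0 <= (1 + K ^+ 2) * K * d.
    by rewrite !mulr_ge0// addr_ge0// sqr_ge0.
  by move: de; lra.
(* the Galerkin eigenvalue lies in [m, m - 1 + K^2] *)
have mu1 : m <= mu.
  have := q_lower Vx; rewrite xmu// ReZ -(nm_sq ipP) ler_pM2r//.
  by rewrite exprn_gt0.
have mu2 : `|m - 1 - mu| <= K ^+ 2.
  rewrite ler0_norm; last by lra.
  rewrite -(@ler_pM2r _ (N x ^+ 2)) ?exprn_gt0// -exprMn.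
  have : Na x ^+ 2 <= (K * N x) ^+ 2.
    by rewrite ler_sqr ?nnegrE ?ip_norm_ge0 ?mulr_ge0 ?nm_ge0// XK.
  rewrite (ip_norm_sq (form_ip_positive ipP q_herm q_lower))// Re_form_ip.
  rewrite xmu// ReZ -!(nm_sq ipP); lra.
pose c j := ip x (g j).
pose z := \sum_j ((Num.sg (la j - mu))%:C * c j) *: g j.
have Ez : E z by exact: (onb_sum Es gE).
have Vz := EV Ez.
have Nz : N z <= N x.
  pose p := \sum_j c j *: g j; have Ep : E p by exact: (onb_sum Es gE).
  rewrite (@le_trans _ _ (N p))//.
    rewrite -ler_sqr ?nnegrE ?nm_ge0// (onb_nm_sq ipP gE Ez) (onb_nm_sq ipP gE Ep).
    apply: ler_sum => j _; rewrite !(onb_coord ipP gE) modulusM modulus_real.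
    rewrite exprMn -[leRHS]mul1r ler_wpM2r ?sqr_ge0// real_normK ?num_real//.
    by rewrite sqr_sg; case: (_ == _) => /=; rewrite ?lexx ?ler01.
  by rewrite /p -(orthproj_onb ipP Es gE); exact: (orthproj_nm ipP Es gE).
have [y Xy zy] := unif z Ez; have Vy := XV _ Xy.
have Vzy : V (z - y) by exact: subspaceB.
have key : complex.Re (q x z) - mu * complex.Re (ip x z) <=
    (1 + K ^+ 2) * K * d * N x ^+ 2.
  have -> : complex.Re (q x z) - mu * complex.Re (ip x z) =
      complex.Re (q x (z - y)) - mu * complex.Re (ip x (z - y)).
    by rewrite (hermBr q_herm)// (ipBr ipP) (xmu y Xy) !ReB ReZ; ring.
  rewrite (le_trans (form_shift_le ipP q_herm q_lower mu Vx Vzy))//.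
  have -> : (1 + K ^+ 2) * K * d * N x ^+ 2 =
      (1 + K ^+ 2) * (K * N x) * (d * N x) by ring.
  rewrite ler_pM ?mulr_ge0 ?ip_norm_ge0 ?addr_ge0//.
    by rewrite ler_pM ?ip_norm_ge0 ?addr_ge0 ?lerD2l// XK.
  by rewrite (le_trans zy)// ler_wpM2l.
have low : e * \sum_j modulus (c j) ^+ 2 <=
    complex.Re (q x z) - mu * complex.Re (ip x z).
  have Vg j : V (g j) by apply: EV; exact: (onb_in gE).
  rewrite (herm_sumr q_herm)//; last by move=> j; exact: (subspaceZ _ Vs).
  rewrite (ip_sumr ipP) !Re_sum !mulr_sumr -sumrB; apply: ler_sum => j _.
  rewrite (hermZr q_herm)// (ipZr ipP) conjM conjc_real.
  have -> : q x (g j) = (la j)%:C * c j.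
    by rewrite /c (hermC q_herm)// g_eig// conjM conjc_real (ipJ ipP).
  rewrite -/(c j); set s := Num.sg _.
  have -> : s%:C * conjc (c j) * ((la j)%:C * c j) =
    (s * la j)%:C * (c j * conjc (c j)) by rewrite realCM; ring.
  have -> : s%:C * conjc (c j) * c j = s%:C * (c j * conjc (c j)) by ring.
  rewrite -modulus_sq !ReZ [complex.Re _]/=.
  have -> : s * la j * modulus (c j) ^+ 2 - mu * (s * modulus (c j) ^+ 2) =
    s * (la j - mu) * modulus (c j) ^+ 2 by ring.
  by rewrite -normrEsg ler_wpM2r ?sqr_ge0// ltW.
have [v Ev xv] := near x Xx; have Vv := EV Ev.
have Nxp : N (x - orthproj ip E x) <= d * N x.
  rewrite (le_trans (orthproj_best ipP x Es gE Ev))// (le_trans _ xv)//.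
  apply: (nm_le_form_norm ipP q_herm q_lower); exact: subspaceB.
have Np : N x / 2 <= N (orthproj ip E x).
  have h := nm_triangle ipP (x - orthproj ip E x) x 0.
  rewrite !subr0 opprB addrCA subrr addr0 in h.
  have := ler_wpM2r (ltW Nx) d1; lra.
have Np2 : (N x / 2) ^+ 2 <= \sum_j modulus (c j) ^+ 2.
  have -> : \sum_j modulus (c j) ^+ 2 = N (orthproj ip E x) ^+ 2.
    have Epx := orthproj_in ipP Es gE x.
    rewrite (onb_nm_sq ipP gE Epx); apply: eq_bigr => j _.
    by rewrite (orthproj_ip ipP Es gE)//; exact: (onb_in gE).
  by rewrite ler_sqr ?nnegrE ?nm_ge0// divr_ge0// nm_ge0.
have := ler_wpM2l e0 Np2.
have := ltr_pM2r (exprn_gt0 2 Nx) ((1 + K ^+ 2) * K * d) (e / 4).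
rewrite de exprMn => h1 h2.
have : e / 4 * N x ^+ 2 <= (1 + K ^+ 2) * K * d * N x ^+ 2.
  have -> : e / 4 * N x ^+ 2 = e * (N x ^+ 2 * 2^-1 ^+ 2) by field.
  by rewrite (le_trans h2)// (le_trans low).
by rewrite leNgt h1.
Qed.

(** If all Galerkin eigenvalues are far from [la j], the residual of an
    approximation [x] of [g j] is not small. *)
Lemma eigenvalue_near_galerkin X (e d : R) j :
  findim_subspace X -> X `<=` V -> (forall x, X x -> Na x <= K * N x) ->
  (exists2 x, X x & Na (g j - x) <= d) -> 0 < e ->
  ((1 + `|m - 1 - la j|) * K + e) * d < e ->
  exists2 mu, galerkin_spectrum ip q X mu & `|la j - mu| <= e.
Proof.
move=> Xf XV XK [x Xx gx] e0 de.
have [l [f [mu [Xs fX fmu]]]] := galerkin_diag ipP q_herm XV Xf.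
apply: contrapT => far.
have mu_far i : e < `|mu i - la j|.
  rewrite ltNge; apply/negP => h; apply: far; exists (mu i); last by rewrite distrC.
  exists (f i); split; [exact: (onb_in fX)|exact: (onb_neq0 ipP fX)|].
  move=> v Xv; have Xf' := onb_in fX i.
  rewrite (hermC q_herm); [|exact: XV|exact: XV].
  by rewrite fmu// conjM conjc_real (ipJ ipP).
pose y := \sum_i ((mu i - la j)%:C * ip x (f i)) *: f i.
have Xy : X y by exact: (onb_sum Xs fX).
have Vx := XV _ Xx; have Vy := XV _ Xy.
have Vg : V (g j) by apply: EV; exact: (onb_in gE).
have Vxg : V (x - g j) by exact: subspaceB.
have yE : N y ^+ 2 = complex.Re (q x y) - la j * complex.Re (ip x y).
  rewrite (galerkin_form_expand q_herm XV fX fmu Xx Xy).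
  rewrite (onb_nm_sq ipP fX Xy) (onb_parseval ipP fX x Xy) !Re_sum mulr_sumr -sumrB.
  apply: eq_bigr => i _; rewrite ReZ -mulrBl (onb_coord ipP fX).
  rewrite conjM conjc_real [X in complex.Re X]mulrCA ReZ -modulus_sq.
  rewrite [complex.Re _]/= modulusM modulus_real exprMn real_normK ?num_real//.
  by rewrite expr2 -mulrA.
have xE : complex.Re (q x y) - la j * complex.Re (ip x y) =
    complex.Re (q (x - g j) y) - la j * complex.Re (ip (x - g j) y).
  by rewrite (hermBl q_herm)// (ipBl ipP) g_eig// !ReB ReZ; ring.
have d0 : 0 <= d by apply: le_trans gx; exact: ip_norm_ge0.
pose C := 1 + `|m - 1 - la j|.
have C0 : 0 <= C by rewrite addr_ge0.
have gaP := form_ip_positive ipP q_herm q_lower.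
have gx' : Na (x - g j) <= d by rewrite (ip_normB gaP Vx Vg).
have Ny : N y <= C * K * d.
  have [->|y0] := eqVneq y 0; first by rewrite (nm0 ipP) !mulr_ge0.
  rewrite -(ler_pM2r (nm_gt0 ipP y0)) -expr2 yE xE.
  rewrite (le_trans (form_shift_le ipP q_herm q_lower (la j) Vxg Vy))//.
  have -> : C * K * d * N y = C * d * (K * N y) by ring.
  rewrite ler_pM ?mulr_ge0 ?ip_norm_ge0//; last exact: XK.
  by rewrite ler_pM ?ip_norm_ge0.
have Nyx : e * N x <= N y.
  rewrite -ler_sqr ?nnegrE ?mulr_ge0 ?nm_ge0 ?(ltW e0)// exprMn.
  rewrite (onb_nm_sq ipP fX Xx) (onb_nm_sq ipP fX Xy) mulr_sumr.
  apply: ler_sum => i _; rewrite (onb_coord ipP fX) modulusM modulus_real exprMn.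
  by rewrite ler_wpM2r ?sqr_ge0// ler_sqr ?nnegrE ?(ltW e0)// ltW.
have Nx : 1 - d <= N x.
  rewrite lerBlDr -(onb_nm ipP gE j).
  have := nm_triangle ipP (g j - x) (g j) 0.
  rewrite !subr0 opprB addrCA subrr addr0 => /le_trans; apply; rewrite lerD2l.
  rewrite (le_trans _ gx)//; apply: (nm_le_form_norm ipP q_herm q_lower).
  exact: subspaceB.
have := ler_wpM2l (ltW e0) Nx; move: de; rewrite -/C; lra.
Qed.

Theorem galerkin_spectrum_cvg (X : nat -> set H) :
  (forall n, findim_subspace (X n)) -> (forall n, X n `<=` V) ->
  (forall n x, X n x -> Na x <= K * N x) ->
  (forall e : R, 0 < e -> \forall n \near \oo,
     forall x, X n x -> exists2 v, E v & Na (x - v) <= e * N x) ->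
  (forall e : R, 0 < e -> \forall n \near \oo,
     forall u, E u -> exists2 x, X n x & Na (u - x) <= e * N u) ->
  hausdorff_dist (galerkin_spectrum ip q (X n)) (range la) @[n --> \oo] --> 0%E.
Proof.
move=> Xf XV XK near unif; apply: hausdorff_cvg0 => e e0.
  have D0 : 0 < (1 + K ^+ 2) * K + 1.
    by rewrite ltr_wpDl// mulr_ge0// addr_ge0// sqr_ge0.
  pose d := Num.min 2^-1 (e / 8 / ((1 + K ^+ 2) * K + 1)).
  have d0 : 0 < d by rewrite lt_min invr_gt0 ltr0n/= !divr_gt0.
  have d1 : 0 <= d <= 2^-1 by rewrite (ltW d0) ge_min lexx.
  have de : (1 + K ^+ 2) * K * d < e / 4.
    have : d * ((1 + K ^+ 2) * K + 1) <= e / 8.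
      by rewrite -ler_pdivlMr// ge_min lexx orbT.
    by move: d0 e0; lra.
  move: (near _ d0) (unif _ d0); apply: filterS2 => n h1 h2 mu mus.
  have [j jmu] := galerkin_eigenvalue_near (findim_is_subspace (Xf n)) (@XV n)
    (XK n) h1 h2 d1 de mus.
  by exists (la j) => //; exists j.
suff : \forall n \near \oo, forall j,
    exists2 mu, galerkin_spectrum ip q (X n) mu & `|la j - mu| <= e.
  by apply: filterS => n h _ [j _ <-].
apply: filter_forall => j.
pose D := (1 + `|m - 1 - la j|) * K + e.
have D0 : 0 < D by rewrite ltr_wpDl// mulr_ge0// addr_ge0.
have d0 : 0 < e / 2 / D by rewrite !divr_gt0.
have := unif _ d0; apply: filterS => n h.
apply: (@eigenvalue_near_galerkin _ e (e / 2 / D)) => //; first exact: XK.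
  have [x Xx gx] := h _ (onb_in gE j); exists x => //.
  by rewrite (le_trans gx)// (onb_nm ipP gE) mulr1.
by rewrite -/D mulrC divfK ?gt_eqF// ltr_pdivrMr//; lra.
Qed.

End GalerkinEigenvalues.

(** * The spectrum of the compressed projection *)

Section FiniteRank.
Context (R : realType) (H : completeNormedModType R[i]).
Context (ip : H -> H -> R[i]) (ipP : inner_product ip).
Context (H_infdim : ~ findim_subspace [set: H]).
Context (F : set H) (Fs : is_subspace F) k (g : 'I_k -> H) (gF : onb ip F g).
Context (th : 'I_k -> R) (T : H -> H).
Hypothesis TE : forall u, T u = \sum_i ((th i)%:C * ip u (g i)) *: g i.
Hypothesis th0 : forall i, th i != 0.
Local Notation N := (ip_norm ip).

Let T_coord u i : ip (T u) (g i) = (th i)%:C * ip u (g i).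
Proof. by rewrite TE (onb_coord ipP gF). Qed.

Let T_eig i : T (g i) = (th i)%:C *: g i.
Proof.
rewrite TE (bigD1 i)//= (onb_ip gF) eqxx mulr1 big1 ?addr0// => j ji.
by rewrite (onb_ip gF) eq_sym (negbTE ji) mulr0 scale0r.
Qed.

Let F_T u : F (T u). Proof. by rewrite TE; exact: (onb_sum Fs gF). Qed.

(** On the basis vector [g i] the inverse of [T - z] is [(th i - z)^-1], and on
    the orthogonal complement of [F] it is [- z^-1]. *)
Lemma finite_rank_resolvent (z : R[i]) : z != 0 ->
  (forall i, z != (th i)%:C) -> resolvent_set (Operator setT T) z.
Proof.
move=> z0 zth.
pose s i := ((th i)%:C - z)^-1 + z^-1.
pose Sf v := \sum_i (s i * ip v (g i)) *: g i - z^-1 *: v.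
have Slin : linear Sf.
  move=> c u v; rewrite /Sf scalerBr scaler_sumr addrACA -big_split/=.
  congr (_ + _); last by rewrite scalerDr opprD !scalerA mulrC.
  apply: eq_bigr => i _; rewrite (ipDl ipP) (ipZl ipP) mulrDr scalerDl scalerA.
  by rewrite mulrCA.
pose S : {linear H -> H} := HB.pack Sf (GRing.isLinear.Build _ _ _ _ Sf Slin).
have thz i : (th i)%:C - z != 0 by rewrite subr_eq0 eq_sym.
have Sc i v : ip (S v) (g i) = ((th i)%:C - z)^-1 * ip v (g i).
  rewrite /= /Sf (ipBl ipP) (onb_coord ipP gF) (ipZl ipP) -mulrBl.
  by rewrite /s addrK.
exists S; split.
- apply: bounded_linear_continuous; apply/linear_boundedP.
  pose C := \sum_i modulus (s i) + modulus z^-1.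
  have CS v : N (S v) <= C * N v.
    rewrite /= /Sf (le_trans (nmB ipP _ _))// mulrDl (nmZ ipP) lerD2r.
    rewrite (le_trans (nm_sum ipP _))// mulr_suml ler_sum// => i _.
    rewrite (nmZ ipP) (onb_nm ipP gF) mulr1 modulusM ler_wpM2l ?modulus_ge0//.
    exact: (onb_coord_le ipP gF).
  exists C%:C; split; first by apply/complex_realP; exists C.
  move=> r Cr v; rewrite !(norm_ip ipP).
  rewrite (@le_trans _ _ (C%:C * (N v)%:C))//; first by rewrite -realCM lecR.
  by apply: ler_wpM2r; [rewrite ler0c nm_ge0|exact: ltW].
- move=> v; split => //=; rewrite TE -[Sf v]/(S v).
  under eq_bigr => i _ do rewrite Sc.
  rewrite /= /Sf scalerBr scalerA mulfV// scale1r opprB addrCA scaler_sumr.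
  rewrite -sumrB big1 ?addr0// => i _; rewrite scalerA -scalerBl.
  rewrite [X in X *: _](_ : _ = 0) ?scale0r// /s.
  by field; rewrite z0 thz.
- move=> u _; rewrite -[RHS]subr0 /= /Sf; apply/eqP.
  rewrite scalerBr scalerA mulVf// scale1r opprB addrCA; apply/eqP; congr (_ + _).
  rewrite TE scaler_sumr -sumrB big1 ?oppr0// => i _.
  rewrite scalerA -scalerBl (ipBl ipP) (ipZl ipP) (onb_coord ipP gF).
  rewrite [X in X *: _](_ : _ = 0) ?scale0r// /s.
  by field; rewrite z0 thz.
Qed.

Let T_eigenvector i : eigenvector (Operator setT T) (th i)%:C (g i).
Proof. by split; [|exact: (onb_neq0 ipP gF)|exact: T_eig]. Qed.

Let T_isolated j : isolated_in (spectrum (Operator setT T)) (th j)%:C.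
Proof.
split; first exact: eigenvalue_spectrum (T_eigenvector j).
have sp w : spectrum (Operator setT T) w -> w = 0 \/ exists i, w = (th i)%:C.
  move=> sw; apply: contrapT => /not_orP[w0 wth]; apply: sw.
  apply: finite_rank_resolvent; first exact/eqP.
  by move=> i; apply/eqP => wi; apply: wth; exists i.
have : \forall e \near (0 : R)^'+, e <= `|th j| /\
    forall i, `|th i - th j| < e -> th i = th j.
  near=> e; split.
    by near: e; apply: nbhs_right_le; rewrite normr_gt0.
  near: e; apply: filter_forall => i; have [->|ij] := eqVneq (th i) (th j).
    by near=> e.
  near=> e; move=> ie; suff : e <= `|th i - th j| by rewrite leNgt ie.
  by near: e; apply: nbhs_right_le; rewrite normr_gt0 subr_eq0.
move=> he; near (0 : R)^'+ => e.
have [ej ei] : e <= `|th j| /\ forall i, `|th i - th j| < e -> th i = th j.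
  by near: e.
exists e; first by near: e; exact: nbhs_right_gt.
move=> w /sp[->|[i ->]].
  rewrite sub0r normrN modulusC modulus_real ltcR => je.
  by move: ej; rewrite leNgt je.
by rewrite -realCB modulusC modulus_real ltcR => /ei ->.
Unshelve. all: by end_near. Qed.

(** The spectral point zero is not discrete because the kernel of a finite-rank
    operator on an infinite-dimensional space is infinite-dimensional. *)
Lemma finite_rank_discrete_spectrum :
  real_trace (discrete_spectrum (Operator setT T)) = range th.
Proof.
apply/seteqP; split => [x|_ [j _ <-]]; last first.
  split; [exact: T_isolated|by exists (g j); exact: T_eigenvector|].
  have FT u : F u -> F (T u) /\ forall i, ip (T u) (g i) = (th i)%:C * ip u (g i).
    by move=> Fu; split => // i; exact: T_coord.
  have := spectral_span_findim ipP [set th j] Fs gF FT.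
  rewrite (spectral_span_onb ipP [set th j] Fs gF FT).
  congr findim_subspace; apply/seteqP; split => u.
    move=> [Fu uj]; split => //=; apply: (onb_ext gF) => // [|i].
      exact: subspaceZ.
    rewrite T_coord (ipZl ipP); have [->//|ij] := eqVneq (th i) (th j).
    by rewrite uj ?mulr0// => /eqP; rewrite (negbTE ij).
  move=> [_ /= uE].
  have thj : (th j)%:C != 0 by rewrite fmorph_eq0.
  split => [|i ij].
    have -> : u = (th j)%:C^-1 *: T u by rewrite uE scalerA mulVf// scale1r.
    by apply: subspaceZ => //; exact: F_T.
  have := T_coord u i; rewrite uE (ipZl ipP) => /eqP.
  rewrite -subr_eq0 -mulrBl -realCB mulf_eq0 fmorph_eq0 subr_eq0.
  by move=> /orP[/eqP/esym//|/eqP].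
move=> [_ [u [_ u0 /= uE]] ker_fin]; have [x0|xn0] := eqVneq x 0.
  exfalso; apply: H_infdim; move: ker_fin => [S Sf SE].
  exists (S `|` range g); first by rewrite finite_setU; split => //; exact: finite_image.
  apply/seteqP; split => // v _.
  have -> : v = (v - orthproj ip F v) + orthproj ip F v by rewrite subrK.
  apply: (subspaceD (lspan_subspace _)).
    have : lspan S (v - orthproj ip F v).
      rewrite -SE; split => //=; rewrite x0 scale0r TE big1// => i _.
      rewrite (orthproj_orth ipP Fs gF) ?mulr0 ?scale0r//.
      exact: (onb_in gF).
    apply: lspan_sub; first exact: lspan_subspace.
    by move=> y Sy; apply: sub_lspan; left.
  rewrite (orthproj_onb ipP Fs gF); apply: subspace_sum => [|i _].
    exact: lspan_subspace.
  apply: (subspaceZ _ (lspan_subspace _)).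
  by apply: sub_lspan; right; exists i.
have Fu : F u.
  have -> : u = x%:C^-1 *: T u.
    by rewrite uE scalerA mulVf ?scale1r// fmorph_eq0.
  by apply: subspaceZ => //; exact: F_T.
apply: contrapT => xth; move/eqP: u0; apply.
apply: (onb_ext gF) => // [|i]; first exact: subspace0.
have := T_coord u i; rewrite uE (ipZl ipP) (ip0l ipP) => /eqP.
rewrite -subr_eq0 -mulrBl -realCB mulf_eq0 fmorph_eq0 subr_eq0.
by move=> /orP[/eqP xi|/eqP//]; case: xth; exists i.
Qed.

End FiniteRank.

Section EigenBases.
Context (R : realType) (H : completeNormedModType R[i]).
Context (ip : H -> H -> R[i]) (ipP : inner_product ip).
Context (A : operator H) (A_sa : selfadjoint ip A).
Context (a b : R).
Hypothesis ess_Delta : real_trace (essential_spectrum A) `&` `[a, b] = set0.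
Local Notation N := (ip_norm ip).
Local Notation Delta := (`[a, b]%classic : set R).
Local Notation eigs := (real_trace (spectrum A) `&` Delta).
Local Notation LDelta := (spectral_span A Delta).

Let LDs : is_subspace LDelta := lspan_subspace _.

Lemma LDelta_stable u : LDelta u -> LDelta (A u).
Proof.
have Al := selfadjoint_linear A_sa; have As := op_dom_subspace Al.
suff : LDelta `<=` [set v | op_dom A v /\ LDelta (A v)] by move=> h /h[].
apply: lspan_sub => [|{}u [x Dx ux]]; last first.
  have [Au _ uE] := ux; split => //; rewrite uE.
  by apply: (subspaceZ _ LDs); apply: sub_lspan; exists x.
split => [|c v w [Av Lv] [Aw Lw]].
  have A0 := subspace0 As; split => //.
  have := op_linear Al (-1) A0 A0; rewrite !scaleN1r oppr0 addr0 => ->.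
  by rewrite addNr; exact: (subspace0 LDs).
split; first by case: As => _; apply.
by rewrite (op_linear Al)//; case: LDs => _; apply.
Qed.

Lemma LDelta_eigenbasis : exists k (g : 'I_k -> H) (la : 'I_k -> R),
  [/\ onb ip LDelta g, forall j, eigenvector A (la j)%:C (g j) &
    eigs = range la].
Proof.
have Al := selfadjoint_linear A_sa; have sym := selfadjoint_sym A_sa.
have dom := LDelta_dom A_sa (a := a) (b := b).
have [k [f fL]] := findim_onb ipP (LDelta_findim ipP ess_Delta).
have hh : hermitian_on LDelta (fun u v => ip (A u) v).
  split => // [c u v w Lu Lv _|u v Lu Lv].
    by rewrite (op_linear Al) ?(ipDl ipP) ?(ipZl ipP)//; exact: dom.
  by rewrite sym ?(ipC ipP u)//; exact: dom.
have [g [la [gL gla]]] := onb_diag ipP fL hh.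
have eig j : eigenvector A (la j)%:C (g j).
  have Lg := onb_in gL j; split; [exact: dom|exact: (onb_neq0 ipP gL)|].
  apply: (onb_ext gL) => [|//|i]; [exact: LDelta_stable|exact: (subspaceZ _ LDs)|].
  rewrite gla// (ipZl ipP) (onb_ip gL); have [->//|ji] := eqVneq j i.
  by rewrite !mulr0.
exists k, g, la; split => //; apply/seteqP; split => [x ex|_ [j _ <-]].
  have [_ [u ux] _] := spectrum_discrete ess_Delta ex.
  have [Au u0 uE] := ux.
  have Lu : LDelta u by apply: sub_lspan; exists x => //; case: ex.
  apply: contrapT => xla; move/eqP: u0; apply.
  apply: (onb_ext gL) => // [|i]; first exact: (subspace0 LDs).
  have := gla i u Lu; rewrite uE (ipZl ipP) (ip0l ipP) => /eqP.
  rewrite -subr_eq0 -mulrBl -realCB mulf_eq0 fmorph_eq0 subr_eq0.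
  by move=> /orP[/eqP xi|/eqP//]; case: xla; exists i.
have [Ag g0 gE] := eig j; split; first exact: eigenvalue_spectrum (eig j).
(* otherwise g j would be orthogonal to all eigenvectors spanning LDelta *)
apply: contrapT => nD.
have : perp ip LDelta (g j).
  apply: (perp_lspan ipP) => u [x Dx [Au _ uE]].
  have := sym _ _ Ag Au; rewrite gE uE (ipZl ipP) (ipZr ipP) conjc_real => /eqP.
  rewrite -subr_eq0 -mulrBl -realCB mulf_eq0 fmorph_eq0 subr_eq0.
  by move=> /orP[/eqP jx|/eqP//]; case: nD; rewrite jx.
move=> /(_ _ (onb_in gL j)); rewrite (onb_ip gL) eqxx => /eqP.
by rewrite oner_eq0.
Qed.

Context (L : set H) (L_fd : findim_subspace L).
Local Notation E := (orthproj ip LDelta).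
Local Notation P := (orthproj ip L).

(** The eigenvalues of [EPE] on [LDelta] are the squared norms [|P u|^2] of
    its unit eigenvectors, and [P u = 0] would put [u] at distance one from
    [L]. *)
Lemma EPE_eigenbasis : gap ip LDelta L < 1 ->
  exists k (g : 'I_k -> H) (th : 'I_k -> R), [/\ onb ip LDelta g,
    forall i, 0 < th i, forall i, E (P (g i)) = (th i)%:C *: g i &
    forall u, (E \o P \o E) u = \sum_i ((th i)%:C * ip u (g i)) *: g i].
Proof.
move=> gapL; have Ls := findim_is_subspace L_fd.
have [l [gl gL]] := findim_onb ipP L_fd.
have [k [f fL]] := findim_onb ipP (LDelta_findim ipP ess_Delta).
have hP : hermitian_on LDelta (fun u v => ip (P u) v).
  split => // [c u v w _ _ _|u v _ _].
    by rewrite (orthproj_lin ipP Ls gL) (ipDl ipP) (ipZl ipP).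
  by rewrite (orthproj_sym ipP Ls gL) (ipC ipP).
have [g [th [gD gth]]] := onb_diag ipP fL hP.
have EPg i : E (P (g i)) = (th i)%:C *: g i.
  have Lg := onb_in gD i.
  apply: (onb_ext gD) => [|//|j].
  - exact: (orthproj_in ipP LDs gD).
  - exact: (subspaceZ _ LDs).
  rewrite (orthproj_ip ipP LDs gD) ?gth//; last exact: (onb_in gD).
  rewrite (ipZl ipP) (onb_ip gD); have [->//|ij] := eqVneq i j.
  by rewrite !mulr0.
have thE i : th i = N (P (g i)) ^+ 2.
  rewrite (nm_sq ipP) (orthproj_ip ipP Ls gL); last exact: (orthproj_in ipP Ls gL).
  rewrite (Re_ipC ipP) gth; last exact: (onb_in gD).
  by rewrite (onb_ip gD) eqxx mulr1.
exists k, g, th; split => // [i|u].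
  rewrite thE exprn_gt0//; apply: (nm_gt0 ipP); apply/eqP => Pg0.
  suff : 1 <= gap ip LDelta L by rewrite leNgt gapL.
  have d1 : 1 <= dist_to ip (g i) L.
    apply: lb_le_inf; first by exists (N (g i - 0)), 0 => //; exact: subspace0.
    move=> _ [v Lv <-]; rewrite -ler_sqr ?nnegrE ?nm_ge0// expr1n.
    rewrite (nm_sqD ipP) (onb_nm ipP gD) (ipNr ipP) ReN.
    have -> : ip (g i) v = 0.
      by rewrite -(orthproj_ip ipP Ls gL)// Pg0 (ip0l ipP).
    by rewrite oppr0 mulr0 addr0 expr1n lerDl sqr_ge0.
  rewrite (le_trans d1)//; apply: ub_le_sup; last first.
    by exists (g i) => //; split; [exact: (onb_in gD)|exact: (onb_nm ipP gD)].
  exists 1 => _ [v [_ v1] <-]; rewrite -v1; apply: ge_inf.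
    by exists 0 => _ [w _ <-]; exact: ip_norm_ge0.
  by exists 0; [exact: subspace0|rewrite subr0].
rewrite /= [E u](orthproj_onb ipP LDs gD) (orthproj_sum ipP _ Ls gL).
rewrite (orthproj_sum ipP _ LDs gD); apply: eq_bigr => i _.
by rewrite (orthprojZ ipP _ _ Ls gL) (orthprojZ ipP _ _ LDs gD) EPg scalerA mulrC.
Qed.

End EigenBases.

Lemma dot_inner_product (R : realType) (H : normedModType R[i])
    (ip : {dot H for (@Num.conj R[i])}) :
  (forall u : H, ip u u = `|u| ^+ 2) -> inner_product ip.
Proof.
move=> ipE; split => //; split => // [c u v w _ _ _|u v _ _].
  by rewrite linearDl linearZl_LR.
by have := hermitian_subproof (s := ip) u v; rewrite /= expr0 mul1r.
Qed.

(** * Convergence of the selected subspaces and of their eigenvalues *)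

Theorem theorem4p3 (R : realType) (H : completeNormedModType R[i])
    (ip : {dot H for (@Num.conj R[i])})
    (ip_normE : forall u : H, ip u u = `|u| ^+ 2)
    (H_infdim : ~ findim_subspace [set: H])
    (A : operator H) (A_sa : selfadjoint ip A)
    (A_bdd : bounded_operator A \/ semibounded_operator ip A)
    (q : qform H) (qA : form_of ip A q)
    (m : R) (m_min : is_min (real_trace (spectrum A)) m)
    (a b : R) (lt_ab : a < b)
    (rho_a : resolvent_set A a%:C) (rho_b : resolvent_set A b%:C)
    (ess_Delta : real_trace (essential_spectrum A) `&` `[a, b] = set0)
    (L_ : nat -> set H)
    (L_findim : forall n, findim_subspace (L_ n))
    (L_sub : forall n, L_ n `<=` form_dom q)
    (L_approx : forall u, form_dom q u ->
       exists u_ : nat -> H, (forall n, L_ n (u_ n)) /\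
         ip_norm (form_ip ip q m) (u - u_ n) @[n --> \oo] --> (0 : R))
    (L : set H) (L_fd : findim_subspace L) :
  let Delta : set R := `[a, b]%classic in
  let eigs := real_trace (spectrum A) `&` Delta in
  let LDelta := spectral_span A Delta in
  let E := orthproj ip LDelta in
  let P := orthproj ip L in
  let LnDelta n := spectral_span (galerkin_operator ip q (L_ n)) Delta in
  let Q n := orthproj ip (LnDelta n) in
  let EPE := Operator setT (E \o P \o E) in
  eigs !=set0 ->
  gap ip LDelta L < 1 ->
  exists gamma : R,
    [/\ is_min (real_trace (discrete_spectrum EPE)) gamma,
        0 < gamma &
        let M n := spectral_span (Operator (LnDelta n) (Q n \o P))
                     `[gamma / 2, 1]%classic in
        [/\ gap_hat ip (M n) LDelta @[n --> \oo] --> (0 : R),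
            bounded_operator A ->
              hausdorff_dist (galerkin_spectrum ip q (M n)) eigs
                @[n --> \oo] --> 0%E &
            semibounded_operator ip A ->
              gap_hat (form_ip ip q m) (M n) LDelta @[n --> \oo] --> (0 : R) /\
              hausdorff_dist (galerkin_spectrum ip q (M n)) eigs
                @[n --> \oo] --> 0%E] ].
Proof.
move=> Delta eigs LDelta E P LnDelta Q EPE eigs0 gapL.
have ipP := dot_inner_product ip_normE.
have [k [g [th [gE th0 EPg EPEE]]]] := EPE_eigenbasis ipP ess_Delta L_fd gapL.
have [k' [f [la [fE f_eig eigsE]]]] := LDelta_eigenbasis ipP A_sa ess_Delta.
have LDs : is_subspace LDelta by exact: lspan_subspace.
have [i0 _] : exists i : 'I_k, True.
  move: eigs0; rewrite /eigs eigsE => -[_ [j _ _]].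
  have fj0 := onb_neq0 ipP fE j; case: k g th gE th0 EPg EPEE => [|k] g th gE _ _ _.
    by move: fj0; rewrite (onb_expand gE (onb_in fE j)) big_ord0 eqxx.
  by exists ord0.
have [j thj] : exists j, forall i, th j <= th i.
  by case: (arg_minP th (isT : predT i0)) => j _ jP; exists j => i; exact: jP.
have dE : real_trace (discrete_spectrum EPE) = range th.
  apply: (finite_rank_discrete_spectrum ipP H_infdim LDs gE EPEE) => i.
  by rewrite gt_eqF.
exists (th j); split => //.
  by rewrite dE; split => [|_ [i _ <-]]; [exists j|exact: thj].
move=> M.
have q_herm := form_hermitian qA.
have q_lower := form_lower_bound ipP qA m_min.
have Mgap : gap_hat ip (M n) LDelta @[n --> \oo] --> (0 : R).
  exact: (M_gap_cvg ipP A_sa qA m_min lt_ab rho_a rho_b ess_Delta L_findim L_sub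
    L_approx L_fd (th0 j) gE thj EPg).
have Mform : gap_hat (form_ip ip q m) (M n) LDelta @[n --> \oo] --> (0 : R).
  exact: (M_form_gap_cvg ipP A_sa qA m_min lt_ab rho_a rho_b ess_Delta L_findim
    L_sub L_approx L_fd (th0 j) gE thj EPg).
have Mspec : hausdorff_dist (galerkin_spectrum ip q (M n)) eigs
    @[n --> \oo] --> 0%E.
  rewrite /eigs eigsE.
  have f_form i v : form_dom q v -> q (f i) v = (la i)%:C * ip (f i) v.
    move=> Vv; have [Af _ fiE] := f_eig i.
    by have [_ ->] := op_form qA Af Vv; rewrite fiE (ipZl ipP).
  apply: (galerkin_spectrum_cvg ipP q_herm q_lower (sqrtr_ge0 `|b - m + 1|) LDs
    (LDelta_form A_sa qA (a := a) (b := b)) fE f_form (X := M)).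
  - exact: (M_findim ipP qA a b L_findim L_sub L_fd).
  - by move=> n; exact: (M_form L_findim L_sub).
  - move=> n x Mx; apply: (LnDelta_form_norm ipP qA m_min L_findim L_sub).
    exact: M_sub Mx.
  - exact: (M_form_near_LDelta ipP A_sa qA m_min lt_ab rho_a rho_b ess_Delta
      L_findim L_sub L_approx L_fd (th0 j) gE).
  - exact: (M_form_uniform ipP A_sa qA m_min lt_ab rho_a rho_b ess_Delta
      L_findim L_sub L_approx L_fd (th0 j) gE thj EPg).
by split.
Qed.
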